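(* Let $P$ and $Q$ be convex rational polytopes in $\mathbb R^n$ with $\dim P=d\ge\dim Q$. If $\dim Q>0$ and $Q$ is inscribed in $P$, then for all sufficiently large integers $t$, $$\mathrm{ehr}(P,Q;-t)=(-1)^d\,\mathrm{ehr}^\circ(P,Q;t+2),$$ namely, $$\mathrm{ehr}^\circ(P,Q;t)=(-1)^d\,\mathrm{ehr}(P,Q;-t+2).$$
   Context: $S^\circ$ denotes the relative interior of $S\subset\mathbb R^n$. For a positive integer $t$, $$\mathrm{ehr}(P,Q;t):=\#\{\mathbf a\in\mathbb Z^n : Q+\mathbf a\subset tP\},\qquad \mathrm{ehr}^\circ(P,Q;t):=\#\{\mathbf a\in\mathbb Z^n : Q+\mathbf a\subset (tP)^\circ\}.$$ These functions agree with quasi-polynomials in $t$ for all sufficiently large $t$; for negative arguments $s$, $\mathrm{ehr}(P,Q;s)$ denotes the value at $s$ of the quasi-polynomial that agrees with $\mathrm{ehr}(P,Q;\cdot)$ at all sufficiently large positive integers. For $\dim Q>0$, $Q$ is inscribed in $P$ if $Q\subset P$ and every facet of $P$ contains at least one vertex of $Q$. *)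

(* Defs.v *)
From HB Require Import structures.
From mathcomp Require Import all_boot all_order all_algebra.
From mathcomp Require Import finmap.
From mathcomp Require Import all_classical all_reals all_analysis.
Set Implicit Arguments.
Unset Strict Implicit.
Unset Printing Implicit Defensive.
Import Order.TTheory GRing.Theory Num.Theory.
Import numFieldNormedType.Exports.
Local Open Scope classical_set_scope.
Local Open Scope ring_scope.

Section Polytopes.
Variables (R : realType) (n : nat).
Implicit Types (S F P Q : set 'rV[R]_n).

(* A finite family of points is given by the rows of a k x n matrix. *)
Definition conv_rows (k : nat) (V : 'M[R]_(k, n)) : set 'rV[R]_n :=
  [set w *m V | w in [set w : 'rV[R]_k |
     (forall i, 0 <= w ord0 i) /\ \sum_i w ord0 i = 1]].

Definition rational_polytope P : Prop :=
  exists k, exists V : 'M[rat]_(k, n), P = conv_rows (map_mx ratr V).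

Definition affine_hull S : set 'rV[R]_n :=
  [set y | exists k, exists V : 'M[R]_(k, n), exists w : 'rV[R]_k,
     [/\ forall i, S (row i V), \sum_i w ord0 i = 1 & y = w *m V]].

(* x0 and the rows of V are k+1 affinely independent points of S. *)
Definition has_aff_indep S (k : nat) : Prop :=
  exists x0 : 'rV[R]_n, exists V : 'M[R]_(k, n),
    [/\ S x0, forall i, S (row i V) & row_free (\matrix_i (row i V - x0))].

(* The dimension of the affine hull of S: one less than the largest number of
   affinely independent points of S. The empty set gets the value 0, not -1. *)
Definition dimension S : nat :=
  \max_(k < n.+1 | `[< has_aff_indep S k >]) k.

Definition relint S : set 'rV[R]_n :=
  [set x | S x /\ within (affine_hull S) (nbhs x) S].

Definition dotp (c x : 'rV[R]_n) : R := \sum_i c ord0 i * x ord0 i.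

Definition face P F : Prop :=
  exists (c : 'rV[R]_n) (b : R),
    (forall x, P x -> dotp c x <= b) /\ F = P `&` [set x | dotp c x = b].

(* Nonemptiness matters when P is a segment, since dimension set0 = 0. *)
Definition facet P F : Prop :=
  [/\ face P F, F !=set0 & (dimension F).+1 = dimension P].

Definition vertex P (v : 'rV[R]_n) : Prop := face P [set v].

Definition inscribed Q P : Prop :=
  Q `<=` P /\ forall F, facet P F -> exists2 v, vertex Q v & F v.

Definition dilate (t : int) P : set 'rV[R]_n := [set t%:~R *: x | x in P].

Definition translate Q (a : 'rV[int]_n) : set 'rV[R]_n :=
  [set x + map_mx intr a | x in Q].

(* fset_set sends an infinite set to the empty one; the sets below are finite
   as soon as P is bounded and Q is nonempty. *)
Definition ehr_count P Q (t : int) : nat :=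
  #|` fset_set [set a | translate Q a `<=` dilate t P]%classic |%fset.

Definition ehr_int P Q (t : int) : nat :=
  #|` fset_set [set a | translate Q a `<=` relint (dilate t P)]%classic |%fset.

End Polytopes.

Section QuasiPolynomials.
Variable R : realType.
Implicit Types f g : int -> R.

(* A polynomial in t whose coefficients are periodic functions of t. *)
Definition quasi_polynomial f : Prop :=
  exists (N : nat) (p : int -> {poly R}),
    [/\ (0 < N)%N, forall t, p (t + N%:Z) = p t &
        forall t, f t = (p t).[t%:~R]].

Definition eventually_equal f g : Prop :=
  exists T : int, forall t, T <= t -> f t = g t.

Lemma quasi_polynomial_unique f g :
  quasi_polynomial f -> quasi_polynomial g -> eventually_equal f g -> f = g.
Proof.
move=> [N [p [N0 pN fp]]] [M [q [M0 qM gq]]] [T fgT].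
have per (L : nat) (h : int -> {poly R}) : (forall t, h (t + L%:Z) = h t) ->
    forall (k : nat) t, h (t + (L * k)%N%:Z) = h t.
  move=> hL; elim=> [|k IH] t; first by rewrite muln0 addr0.
  by rewrite mulnSr PoszD addrA hL IH.
apply/funext => t; rewrite fp gq; congr (_.[_]).
pose s (k : nat) : int := t + (N * M * (k + `|T - t|))%N%:Z.
have rs k : root (p t - q t) (s k)%:~R.
  have psk : p (s k) = p t by rewrite /s -mulnA per.
  have qsk : q (s k) = q t by rewrite /s [(N * M)%N]mulnC -mulnA per.
  rewrite rootE hornerD hornerN -[in X in X - _]psk -[in X in _ - X]qsk.
  rewrite -fp -gq fgT ?subrr//.
  rewrite /s -lerBlDl (le_trans (lez_abs _))// lez_nat.
  by rewrite (leq_trans (leq_addl k _))// leq_pmull// muln_gt0 N0.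
apply/eqP; rewrite -subr_eq0; apply: contraT => d0.
have := @max_poly_roots _ _ [seq (s k)%:~R | k <- iota 0 (size (p t - q t))] d0.
rewrite size_map size_iota ltnn; apply; first by apply/allP => _ /mapP[k _ ->].
rewrite map_inj_uniq ?iota_uniq// => k l /eqP.
rewrite eqr_int /s (inj_eq (addrI _)) eqz_nat eqn_pmul2l ?muln_gt0 ?N0//.
by rewrite eqn_add2r => /eqP.
Qed.

End QuasiPolynomials.

Section Ehr.
Variables (R : realType) (n : nat).
Implicit Types P Q : set 'rV[R]_n.

(* The quasi-polynomial that agrees with ehr_count at all large integers; it is
   determined by this property, by quasi_polynomial_unique. *)
Definition ehr_quasi P Q : int -> R :=
  xget (fun=> 0) [set f | quasi_polynomial f /\
    eventually_equal f (fun t => (ehr_count P Q t)%:R)].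

Definition ehr P Q (s : int) : R :=
  if 0 < s then (ehr_count P Q s)%:R else ehr_quasi P Q s.

End Ehr.

(* Main.v *)
(* Since [Q] is contained in [P] and touches every facet, [Q + a] lies in [tP]
   exactly when [a] lies in [(t - 1)P], and likewise for the relative interiors;
   so the theorem is Ehrhart-Macdonald reciprocity for [P], shifted by one.

   Reciprocity is obtained by eliminating the integer variables one at a time.
   Fix a total order on the linear forms in [(t, x)] and, where a form vanishes,
   decide by its sign in that order whether it counts as satisfied; reversing
   the order exchanges strict and non-strict inequalities consistently. Among
   the lower (upper) bounds that a system puts on a variable exactly one is then
   the effective one, so the region splits into disjoint pieces on which the
   innermost sum of [f] telescopes to [G (upper) - G (lower)], with [G] a
   discrete antiderivative of [f]. Negating all the variables and reversing the
   order turns this into its opposite, hence one sign per variable. When all the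
   facet forms of [P] are positive in the order, the region is [tP], and for the
   reversed order it is the relative interior of [tP]. *)
Require Import Defs.
From mathcomp Require Import all_boot all_order all_algebra.
From mathcomp Require Import finmap.
From mathcomp Require Import all_classical all_reals all_analysis.
From mathcomp Require Import ring lra zify.
Set Implicit Arguments.
Unset Strict Implicit.
Unset Printing Implicit Defensive.
Import Order.TTheory GRing.Theory Num.Theory.
Local Open Scope ring_scope.

(** * Orders on linear forms and integer Fourier-Motzkin elimination *)

(** A telescoped sum [G (upper) - G (lower)] is right only while the bounds do not cross, and the
    closed and the open count must be cut along the same forms although they treat ties differently.
    Reading satisfaction at a point as positivity in a total order settles both: among distinct
    bounds one is always strictly effective, and crossing bounds leave no integer between them.
    Rounding rational bounds forces the summands to be quasi-polynomials even if the first one is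
    constant. The elimination ends with forms in [t] alone, whose truth at [t > 0] depends neither
    on [t] nor on the order; hence one function describes both counts. If [P] is not
    full-dimensional, only [d] coordinates are independent. Integrality of the others becomes a
    periodic, even summand, so that exactly [d] signs appear. Being inscribed is a condition on
    facets, while [P] is given by points. So rational inequalities are derived from the points and
    thinned out until each of them defines a facet. *)

Definition irange (B : nat) : seq int := [seq k%:Z - B%:Z | k <- iota 0 (B.*2.+1)].

Section Forms.
Variables (R : archiRealFieldType) (N : nat).
Implicit Types (l a b : 'rV[rat]_N) (x : 'rV[R]_N) (pos : pred 'rV[rat]_N).

Definition ev l x : R := \sum_i ratr (l ord0 i) * x ord0 i.

Lemma evDl a b x : ev (a + b) x = ev a x + ev b x.
Proof.
by rewrite -big_split; apply: eq_bigr => i _; rewrite mxE rmorphD mulrDl.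
Qed.

Lemma evZl c a x : ev (c *: a) x = ratr c * ev a x.
Proof.
by rewrite mulr_sumr; apply: eq_bigr => i _; rewrite mxE rmorphM mulrA.
Qed.

Lemma evNl a x : ev (- a) x = - ev a x.
Proof. by rewrite -scaleN1r evZl rmorphN1 mulN1r. Qed.

Lemma evBl a b x : ev (a - b) x = ev a x - ev b x.
Proof. by rewrite evDl evNl. Qed.

Lemma ev0l x : ev 0 x = 0.
Proof. by rewrite -(scale0r 0) evZl rmorph0 mul0r. Qed.

Lemma evDr l x y : ev l (x + y) = ev l x + ev l y.
Proof. by rewrite -big_split; apply: eq_bigr => i _; rewrite mxE mulrDr. Qed.

Lemma evZr l c x : ev l (c *: x) = c * ev l x.
Proof. by rewrite mulr_sumr; apply: eq_bigr => i _; rewrite mxE mulrCA. Qed.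

Lemma evNr l x : ev l (- x) = - ev l x.
Proof. by rewrite -scaleN1r evZr mulN1r. Qed.

Lemma evBr l x y : ev l (x - y) = ev l x - ev l y.
Proof. by rewrite evDr evNr. Qed.

Lemma ev_coord j x : ev (delta_mx ord0 j) x = x ord0 j.
Proof.
rewrite /ev (bigD1 j)//= big1 ?addr0 ?mxE ?eqxx ?rmorph1 ?mul1r// => i ij.
by rewrite mxE (negPf ij) andbF rmorph0 mul0r.
Qed.

Lemma ev_delta l j : ev l (delta_mx ord0 j) = ratr (l ord0 j).
Proof.
rewrite /ev (bigD1 j)//= big1 ?addr0 ?mxE ?eqxx ?mulr1// => i ij.
by rewrite mxE (negPf ij) andbF mulr0.
Qed.

(* [pos] is the set of positive forms of a total order on the vector space of
   rational linear forms. *)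
Definition form_order pos : Prop :=
  [/\ ~~ pos 0, forall a b, pos a -> pos b -> pos (a + b),
      forall c a, 0 < c -> pos a -> pos (c *: a) &
      forall a, a != 0 -> pos a || pos (- a)].

Definition opp_order pos : pred 'rV[rat]_N := fun a => pos (- a).

(** Positivity at [x] moved infinitesimally in a direction encoded by [pos]. It serves three times:
    to build an order from coordinate vectors, to express satisfaction at a lattice point, and to
    order forms by their value at an interior point. *)
Definition lex x pos : pred 'rV[rat]_N :=
  fun a => (0 < ev a x) || (ev a x == 0) && pos a.

Lemma opp_form_order pos : form_order pos -> form_order (opp_order pos).
Proof.
case=> p0 pD pZ pT; split; rewrite /opp_order.
- by rewrite oppr0.
- by move=> a b pa pb; rewrite opprD pD.
- by move=> c a c0 pa; rewrite -scalerN pZ.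
- by move=> a a0; rewrite opprK orbC pT.
Qed.

Lemma lexD x pos a b : (forall a b, pos a -> pos b -> pos (a + b)) ->
  lex x pos a -> lex x pos b -> lex x pos (a + b).
Proof.
rewrite /lex evDl => pD /orP[a0|/andP[/eqP -> pa]] /orP[b0|/andP[/eqP -> pb]].
- by rewrite addr_gt0.
- by rewrite addr0 a0.
- by rewrite add0r b0.
- by rewrite addr0 ltxx eqxx pD.
Qed.

Lemma lexZ x pos c a : (forall c a, 0 < c -> pos a -> pos (c *: a)) ->
  0 < c -> lex x pos a -> lex x pos (c *: a).
Proof.
rewrite /lex evZl => pZ c0; have rc0 : 0 < ratr c :> R by rewrite ltr0q.
case/orP=> [a0|/andP[/eqP -> pa]]; first by rewrite mulr_gt0.
by rewrite mulr0 ltxx eqxx pZ.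
Qed.

Lemma lexT x pos a : pos a || pos (- a) -> lex x pos a || lex x pos (- a).
Proof.
rewrite /lex evNl oppr_gt0 oppr_eq0.
by case: ltrgtP => //= _; rewrite ?orbT.
Qed.

Lemma lex_form_order x pos : form_order pos -> form_order (lex x pos).
Proof.
case=> p0 pD pZ pT; split.
- by rewrite /lex ev0l ltxx eqxx.
- by move=> a b; apply: lexD.
- by move=> c a; apply: lexZ.
- by move=> a /pT; apply: lexT.
Qed.

Lemma form_order_exists : exists pos, form_order pos.
Proof.
pose posl (s : seq 'I_N) := foldr (fun i => lex (delta_mx ord0 i)) xpred0 s.
(* For a partial list of coordinates only totality has to be weakened: it holds for forms with a
   nonzero coefficient in the list. *)
have cone s : [/\ ~~ posl s 0,
    forall a b, posl s a -> posl s b -> posl s (a + b),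
    forall c a, 0 < c -> posl s a -> posl s (c *: a) &
    forall a, has (fun i => a ord0 i != 0) s -> posl s a || posl s (- a)].
  elim: s => [|i s [p0 pD pZ pT]] //=; split.
  - by rewrite /lex ev0l ltxx eqxx.
  - by move=> a b; apply: lexD.
  - by move=> c a; apply: lexZ.
  - move=> a /orP[ai|/pT]; last by apply: lexT.
    rewrite /lex evNl oppr_gt0 ev_delta.
    case: (ltrgtP 0 (ratr (a ord0 i) : R)); rewrite ?orbT //.
    by rewrite -[X in X = _](rmorph0 (ratr : rat -> R)) => /fmorph_inj e; rewrite -e eqxx in ai.
have [p0 pD pZ pT] := cone (enum 'I_N).
exists (posl (enum 'I_N)); split=> // a a0; apply: pT.
apply/negPn/negP => /hasPn h; move/eqP: a0; apply; apply/rowP => i; rewrite mxE.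
by apply/eqP/negPn; apply: h; rewrite mem_enum.
Qed.

Section OrderTheory.
Variables (pos : pred 'rV[rat]_N) (op : form_order pos).

Lemma form_order_asym a : pos a -> ~~ pos (- a).
Proof.
by case: op => p0 pD _ _ pa; apply: contra p0 => /(pD _ _ pa); rewrite subrr.
Qed.

Lemma form_order_neg a : a != 0 -> pos (- a) = ~~ pos a.
Proof.
case: op => _ _ _ pT a0; apply/idP/idP => [|/negPf na].
  by move/form_order_asym; rewrite opprK.
by have := pT a a0; rewrite na.
Qed.

Lemma form_order_pZ c a : 0 < c -> pos (c *: a) = pos a.
Proof.
case: op => _ _ pZ _ c0; apply/idP/idP; last exact: pZ.
move/(pZ c^-1); rewrite scalerA mulVf ?lt0r_neq0// scale1r; apply.
by rewrite invr_gt0.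
Qed.

Lemma form_order_max (s : seq 'rV[rat]_N) : s != [::] ->
  exists2 a, a \in s & forall b, b \in s -> b != a -> pos (a - b).
Proof.
elim: s => // a [|c s] IH _.
  by exists a => [|b]; rewrite inE// => /eqP ->; rewrite eqxx.
have [//|m ms mm] := IH.
have [am|nam] := eqVneq a m.
  exists m; first by rewrite inE ms orbT.
  by move=> b; rewrite inE => /orP[/eqP->|/mm//]; rewrite am eqxx.
have [pam|pam] := boolP (pos (a - m)).
  exists a; first by rewrite mem_head.
  move=> b; rewrite inE => /orP[/eqP->|bs ba]; first by rewrite eqxx.
  have [->//|bm] := eqVneq b m.
  by case: op => _ pD _ _; have := pD _ _ pam (mm _ bs bm); rewrite addrA subrK.
exists m; first by rewrite inE ms orbT.
move=> b; rewrite inE => /orP[/eqP-> _|/mm//].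
by rewrite -opprB form_order_neg ?subr_eq0.
Qed.

End OrderTheory.


Definition intv (y : 'rV[int]_N) : 'rV[R]_N := map_mx intr y.

Definition upd (y : 'rV[int]_N) (j : 'I_N) (m : int) : 'rV[int]_N :=
  \row_i (if i == j then m else y ord0 i).

Lemma intvN y : intv (- y) = - intv y.
Proof. by apply/rowP => i; rewrite !mxE rmorphN. Qed.

Lemma upd_eq y j m : upd y j m ord0 j = m.
Proof. by rewrite mxE eqxx. Qed.

Lemma upd_neq y j m i : i != j -> upd y j m ord0 i = y ord0 i.
Proof. by move=> ij; rewrite mxE (negPf ij). Qed.

Lemma updN y j m : - upd y j m = upd (- y) j (- m).
Proof. by apply/rowP => i; rewrite !mxE; case: ifP. Qed.

Lemma upd_sub_delta y j m : upd y j m - delta_mx ord0 j = upd y j (m - 1).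
Proof.
apply/rowP => i; rewrite !mxE eqxx /=.
by case: eqVneq => //= _; rewrite subr0.
Qed.

Lemma ev_upd l y j m : l ord0 j = 0 -> ev l (intv (upd y j m)) = ev l (intv y).
Proof.
move=> lj; apply: eq_bigr => i _; rewrite !mxE.
by case: eqVneq => // ->; rewrite lj rmorph0 !mul0r.
Qed.

(** * Elimination of one integer variable *)

Section Elimination.
Variables (pos : pred 'rV[rat]_N) (op : form_order pos) (j : 'I_N).

Implicit Types (u v : 'rV[rat]_N) (y : 'rV[int]_N) (L : seq 'rV[rat]_N).

Let ej : 'rV[rat]_N := delta_mx ord0 j.

(** A form with [pos l] is read as [l >= 0], one with [pos (- l)] as [l > 0]. Since [sat y] is
    itself a form order, exactly one of [l] and [- l] holds at [y] when [l] is nonzero. *)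
Definition sat y : pred 'rV[rat]_N := lex (intv y) pos.

(* The largest integer value of the [j]-th coordinate at which [v - e_j] is
   satisfied. *)
Definition top (v : 'rV[rat]_N) y : int :=
  if pos (v - ej) then Num.floor (ev v (intv y))
  else Num.ceil (ev v (intv y)) - 1.

Lemma sat_order y : form_order (sat y).
Proof. exact: lex_form_order. Qed.

Lemma sat_upd l y m : l ord0 j = 0 -> sat (upd y j m) l = sat y l.
Proof. by move=> lj; rewrite /sat /lex ev_upd. Qed.

Lemma sat_top v y m : v ord0 j = 0 -> sat (upd y j m) (v - ej) = (m <= top v y).
Proof.
move=> vj; rewrite /sat /lex /top evBl ev_coord ev_upd// !mxE eqxx.
rewrite subr_gt0 subr_eq0; case: ifP => _.
  by rewrite floor_ge_int andbT eq_sym orbC -le_eqVlt.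
by rewrite andbF orbF lerBrDr lezD1 ceil_gt_int.
Qed.

(** [ej - v] is the negation of [v - ej], so by totality its solutions are the complement. Thus
    [top] also gives lower bounds, as exclusive ones, which is the shape that telescopes. *)
Lemma sat_bot v y m : v ord0 j = 0 -> sat (upd y j m) (ej - v) = (top v y < m).
Proof.
move=> vj; rewrite ltNge -sat_top// -opprB (form_order_neg (sat_order _))//.
apply/eqP => /rowP/(_ j); rewrite !mxE vj !eqxx sub0r => /eqP.
by rewrite oppr_eq0 oner_eq0.
Qed.

(** At [m = top b y] the form [b - ej] holds; adding [a - b] gives [a - ej]. Arguing in the order
    covers all combinations of rounding at once. *)
Lemma top_le a b y : a ord0 j = 0 -> b ord0 j = 0 -> sat y (a - b) ->
  top b y <= top a y.
Proof.
move=> aj bj; rewrite -(@sat_upd _ _ (top b y)) ?mxE ?aj ?bj ?subrr// => sab.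
have sb : sat (upd y j (top b y)) (b - ej) by rewrite sat_top.
rewrite -sat_top//.
case: (sat_order (upd y j (top b y))) => _ pD _ _.
by have := pD _ _ sab sb; rewrite addrA subrK.
Qed.

(** The value of the [j]-th coordinate at which [l] vanishes, as a form in the other coordinates:
    [l] is [l ord0 j] times [ej - root_form l]. *)
Definition root_form l : 'rV[rat]_N := ej - (l ord0 j)^-1 *: l.
(** Proportional forms yield the same bound; without [undup] its piece would be counted more than
    once. *)
Definition lows L := undup [seq root_form l | l <- L & 0 < (l : 'rV[rat]_N) ord0 j].
Definition ups L := undup [seq root_form l | l <- L & (l : 'rV[rat]_N) ord0 j < 0].
Definition rests (L : seq 'rV[rat]_N) := [seq l <- L | (l : 'rV[rat]_N) ord0 j == 0].
(** Conditions free of the [j]-th variable under which [v] is the effective lower bound, [u] the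
    effective upper bound, and the two do not cross. They do not mention the order, so the same
    pieces serve an order and its reverse. *)
Definition piece L (v u : 'rV[rat]_N) :=
  [seq v - v' | v' <- lows L & v' != v] ++
  [seq u' - u | u' <- ups L & u' != u] ++ (u - v) :: rests L.

Lemma root_form0 l : l ord0 j != 0 -> root_form l ord0 j = 0.
Proof. by move=> lj; rewrite !mxE !eqxx mulVf// subrr. Qed.

Lemma lows0 L v : v \in lows L -> v ord0 j = 0.
Proof.
rewrite mem_undup => /mapP[l]; rewrite mem_filter => /andP[l0 _] ->.
by rewrite root_form0 ?lt0r_neq0.
Qed.

Lemma ups0 L v : v \in ups L -> v ord0 j = 0.
Proof.
rewrite mem_undup => /mapP[l]; rewrite mem_filter => /andP[l0 _] ->.
by rewrite root_form0 ?ltr0_neq0.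
Qed.

Lemma all_sat_upd L y m : all (sat (upd y j m)) L =
  [&& all (fun v => top v y < m) (lows L), all (fun u => m <= top u y) (ups L)
    & all (sat y) (rests L)].
Proof.
rewrite /lows /ups !(eq_all_r (mem_undup _)).
elim: L => //= l L ->; rewrite /rests /=.
have so := sat_order (upd y j m).
case: (ltrgtP (l ord0 j) 0) => lj /=; last first.
- by rewrite sat_upd// andbCA; congr (_ && _); rewrite andbCA.
- rewrite -sat_bot ?root_form0 ?lt0r_neq0// /root_form subKr.
  by rewrite (form_order_pZ so) ?invr_gt0// andbA.
- rewrite -sat_top ?root_form0 ?ltr0_neq0// /root_form addrAC subrr add0r.
  rewrite -scaleNr (form_order_pZ so) ?oppr_gt0 ?invr_lt0//.
  by rewrite andbCA !andbA.
Qed.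

Lemma telescope_irange (B : nat) (a b : int) (h : int -> R) :
  a <= b -> - B%:Z - 1 <= a -> b <= B%:Z ->
  \sum_(m <- irange B) ((a < m) && (m <= b))%:R * (h m - h (m - 1)) = h b - h a.
Proof.
move=> ab aB bB; rewrite big_map.
(* The partial sums are those of the interval truncated at the last index reached. *)
have tel K : \sum_(k <- iota 0 K)
    ((a < k%:Z - B%:Z) && (k%:Z - B%:Z <= b))%:R * (h (k%:Z - B%:Z) - h (k%:Z - B%:Z - 1)) =
    h (Num.min b (K%:Z - B%:Z - 1)) - h (Num.min a (K%:Z - B%:Z - 1)).
  elim: K => [|K IH].
    rewrite big_nil sub0r !min_r ?subrr//; first by lia.
  rewrite -addn1 iotaD big_cat big_seq1 {}IH add0n.
  have -> : (K + 1)%:Z - B%:Z - 1 = K%:Z - B%:Z by lia.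
  set c := K%:Z - B%:Z.
  have [ac|] /= := boolP (a < c); last first.
    rewrite -leNgt => ca; have cb := le_trans ca ab.
    rewrite mul0r addr0 (min_r ca) (min_r cb).
    by rewrite !min_r ?subrr//; lia.
  rewrite (min_l (ltW ac)) (@min_l _ _ a (c - 1)); last by lia.
  have [cb|] /= := boolP (c <= b).
    rewrite mul1r (min_r cb) (@min_r _ _ b (c - 1)); last by lia.
    by rewrite addrC addrA subrK.
  by rewrite -ltNge => bc; rewrite mul0r addr0 !min_l //; lia.
by rewrite tel !min_l //; lia.
Qed.

(** Which bounds are effective depends on [y], hence the sum over all pairs; at a given [y] only the
    greatest lower root and the least upper root contribute. The two bounds on [top] keep the range
    [irange B] from cutting the interval. *)
Lemma eliminate L B y (f G : 'rV[int]_N -> R) :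
  (forall z, G z - G (z - delta_mx ord0 j) = f z) ->
  (exists2 v, v \in lows L & - B%:Z - 1 <= top v y) ->
  (exists2 u, u \in ups L & top u y <= B%:Z) ->
  \sum_(m <- irange B) (all (sat (upd y j m)) L)%:R * f (upd y j m) =
  \sum_(v <- lows L) \sum_(u <- ups L) (all (sat y) (piece L v u))%:R *
     (G (upd y j (top u y)) - G (upd y j (top v y))).
Proof.
move=> Gf [v1 v1L v1B] [u1 u1L u1B].
have so := sat_order y.
have [|v vL vmax] := form_order_max so (s := lows L); first by case: (lows L) v1L.
have [|u uL umin] := form_order_max (opp_form_order so) (s := ups L).
  by case: (ups L) u1L.
have top_max v' : v' \in lows L -> top v' y <= top v y.
  have [->//|nv v'L] := eqVneq v' v; apply: top_le (vmax _ v'L nv).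
    exact: lows0 vL.
  exact: lows0 v'L.
have top_min u' : u' \in ups L -> top u y <= top u' y.
  have [->//|nu u'L] := eqVneq u' u.
  have := umin _ u'L nu; rewrite /opp_order opprB; apply: top_le.
    exact: ups0 u'L.
  exact: ups0 uL.
have pieceE v' u' : v' \in lows L -> u' \in ups L ->
    all (sat y) (piece L v' u') =
    [&& v' == v, u' == u, sat y (u - v) & all (sat y) (rests L)].
  move=> v'L u'L; rewrite /piece !all_cat /= !all_map.
  have [->|nv] /= := eqVneq v' v; last first.
    apply/negbTE; rewrite negb_and; apply/orP; left; apply/allPn.
    exists v; first by rewrite mem_filter eq_sym nv.
    by rewrite /= -opprB (form_order_asym so)// vmax.
  have -> : all (preim (fun v' => v - v') (sat y)) [seq v' <- lows L | v' != v].
    by apply/allP => w; rewrite mem_filter => /andP[wv wL] /=; apply: vmax.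
  have [->|nu] /= := eqVneq u' u; last first.
    apply/negbTE; rewrite negb_and; apply/orP; left; apply/allPn.
    exists u; first by rewrite mem_filter eq_sym nu.
    rewrite /= -opprB (form_order_asym so)//.
    by have := umin _ u'L nu; rewrite /opp_order opprB.
  have -> // : all (preim (fun u' => u' - u) (sat y)) [seq u' <- ups L | u' != u].
  apply/allP => w; rewrite mem_filter => /andP[wu wL] /=.
  by have := umin _ wL wu; rewrite /opp_order opprB.
rewrite (bigD1_seq v) ?undup_uniq//= [X in _ + X]big1_seq ?addr0; last first.
  move=> v' /andP[nv v'L]; rewrite big1_seq// => u' /andP[_ u'L].
  by rewrite pieceE// (negPf nv) mul0r.
rewrite (bigD1_seq u) ?undup_uniq//= [X in _ + X]big1_seq ?addr0; last first.
  by move=> u' /andP[nu u'L]; rewrite pieceE// (negPf nu) andbF mul0r.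
rewrite pieceE// !eqxx /=.
under eq_bigr => m _.
  rewrite all_sat_upd.
  have -> : all (fun v => top v y < m) (lows L) = (top v y < m).
    apply/allP/idP => [/(_ v vL)//|vm w wL].
    exact: le_lt_trans (top_max _ wL) vm.
  have -> : all (fun u => m <= top u y) (ups L) = (m <= top u y).
    apply/allP/idP => [/(_ u uL)//|um w wL].
    exact: le_trans um (top_min _ wL).
  over.
case: (all _ (rests L)); last first.
  by rewrite andbF mul0r big1// => m _; rewrite !andbF mul0r.
rewrite andbT.
have uj := ups0 uL; have vj := lows0 vL.
have [suv|nsuv] := boolP (sat y (u - v)).
  rewrite mul1r -(@telescope_irange B _ _ (fun m => G (upd y j m))).
  - by apply: eq_bigr => m _; rewrite andbT -Gf upd_sub_delta.
  - exact: top_le.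
  - exact: le_trans v1B (top_max _ v1L).
  - exact: le_trans (top_min _ u1L) u1B.
(* If [u - v] fails, then [u] equals or precedes [v] in the order, and no integer lies above
   [top v y] and up to [top u y]. *)
rewrite mul0r big1// => m _; rewrite andbT.
have: top u y <= top v y.
  have [->//|nuv] := eqVneq u v; apply: top_le => //.
  by rewrite -opprB (form_order_neg so)// subr_eq0.
by case: (ltP (top v y) m) => /= [vm uv|]; rewrite ?mul0r// leNgt (le_lt_trans uv vm) mul0r.
Qed.

End Elimination.
End Forms.

(** * Quasi-polynomial functions and discrete antiderivatives *)

Section PolyAntidifference.
Variable R : numFieldType.

Lemma antidiff_sum n (c : nat -> R) :
  (forall i, (i < n)%N -> exists P : {poly R},
     forall x, P.[x + 1] - P.[x] = x ^+ i) ->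
  exists P : {poly R}, forall x, P.[x + 1] - P.[x] = \sum_(i < n) c i * x ^+ i.
Proof.
elim: n => [|n IH] mono.
  by exists 0 => x; rewrite !horner0 subrr big_ord0.
have [i ltin|P PE] := IH; first by apply: mono; apply: ltnW.
have [Q QE] := mono n (ltnSn n).
exists (P + c n *: Q) => x.
by rewrite big_ord_recr /= -PE -QE !hornerD !hornerZ mulrBr opprD addrACA.
Qed.

(** The difference of [x ^+ k.+1] is [k.+1] times [x ^+ k] plus lower powers, and the lower powers
    have antidifferences by induction. *)
Lemma antidiff_monomial k : exists P : {poly R},
  forall x, P.[x + 1] - P.[x] = x ^+ k.
Proof.
elim/ltn_ind: k => k IH.
have [P PE] := antidiff_sum (fun i => ('C(k.+1, i))%:R) IH.
exists (k.+1%:R^-1 *: ('X^(k.+1) - P)) => x.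
rewrite !hornerZ -mulrBr !hornerD !hornerN !hornerXn opprD addrACA -opprD PE.
rewrite [x + 1]addrC exprDn big_ord_recr /= big_ord_recr /= subnn expr0 mul1r binn mulr1n.
under eq_bigr => i _ do rewrite expr1n mul1r -mulr_natl.
rewrite expr1n mul1r binSn.
set S := \sum_(i < k) _.
rewrite addrK [S + _]addrC addrK -[x ^+ k *+ _]mulr_natl.
by rewrite mulKf// pnatr_eq0.
Qed.

Lemma poly_antidiff (p : {poly R}) : exists P : {poly R},
  forall x, P.[x + 1] - P.[x] = p.[x].
Proof.
have [P PE] := antidiff_sum (n := size p) (fun i => p`_i)
  (fun i _ => antidiff_monomial i).
by exists P => x; rewrite PE horner_coef.
Qed.

End PolyAntidifference.

Section QuasiPolynomialFunctions.
Variables (R : archiRealFieldType) (N : nat).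
Implicit Types (f g : 'rV[int]_N -> R) (y z : 'rV[int]_N).

(** Given by closure rather than by coefficients, so that substitution goes by induction. The
    functions live on all integer vectors, so evaluation at negated arguments is built in. *)
Inductive qpoly : ('rV[int]_N -> R) -> Prop :=
| qpoly_periodic f (M : nat) of (0 < M)%N &
    (forall y z, f (y + z *+ M) = f y) : qpoly f
| qpoly_coord i : qpoly (fun y => (y ord0 i)%:~R)
| qpolyD f g of qpoly f & qpoly g : qpoly (fun y => f y + g y)
| qpolyM f g of qpoly f & qpoly g : qpoly (fun y => f y * g y).

Lemma eq_qpoly f g : f =1 g -> qpoly f -> qpoly g.
Proof. by move=> /funext ->. Qed.

Lemma qpoly_const (c : R) : qpoly (fun=> c).
Proof. by apply: (@qpoly_periodic _ 1). Qed.

Lemma qpolyN f : qpoly f -> qpoly (fun y => - f y).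
Proof.
move=> qf; apply: (@eq_qpoly (fun y => -1 * f y)); first by move=> y; rewrite mulN1r.
by apply: qpolyM => //; apply: qpoly_const.
Qed.

Lemma qpolyB f g : qpoly f -> qpoly g -> qpoly (fun y => f y - g y).
Proof. by move=> qf qg; apply: qpolyD => //; apply: qpolyN. Qed.

Lemma qpoly_sum (I : eqType) (s : seq I) (F : I -> 'rV[int]_N -> R) :
  (forall i, i \in s -> qpoly (F i)) -> qpoly (fun y => \sum_(i <- s) F i y).
Proof.
elim: s => [|i s IH] Fq.
  by apply: eq_qpoly (qpoly_const 0) => y; rewrite big_nil.
apply: (@eq_qpoly (fun y => F i y + \sum_(i <- s) F i y)).
  by move=> y; rewrite big_cons.
apply: qpolyD; first by apply: Fq; rewrite mem_head.
by apply: IH => k ks; apply: Fq; rewrite inE ks orbT.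
Qed.

Lemma qpoly_horner (p : {poly R}) f : qpoly f -> qpoly (fun y => p.[f y]).
Proof.
move=> qf; elim/poly_ind: p => [|p c IH].
  by apply: eq_qpoly (qpoly_const 0) => y; rewrite horner0.
apply: (@eq_qpoly (fun y => p.[f y] * f y + c)).
  by move=> y; rewrite hornerMXaddC.
by apply: qpolyD; [apply: qpolyM|apply: qpoly_const].
Qed.

(** The functions that may replace a coordinate in a quasi-polynomial. The second condition keeps
    periodic functions periodic: long enough shifts change [phi] by multiples of any given [M]. *)
Definition quasi_linear (phi : 'rV[int]_N -> int) : Prop :=
  qpoly (fun y => (phi y)%:~R) /\
  forall M, (0 < M)%N -> exists2 M', (0 < M')%N &
    forall y z, exists w, phi (y + z *+ M') = phi y + w *+ M.

Lemma qpoly_upd f phi j : qpoly f -> quasi_linear phi ->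
  qpoly (fun y => f (upd y j (phi y))).
Proof.
move=> qf [qphi pphi]; elim: qf => {f} [f M M0 pf|i|f g _ qf _ qg|f g _ qf _ qg].
- have [M' M'0 M'P] := pphi M M0.
  (* The factor [M] takes care of the untouched coordinates, the factor [M'] of the substituted
     one. *)
  apply: (@qpoly_periodic _ (M * M')%N); first by rewrite muln_gt0 M0.
  move=> y z; have [w wE] := M'P y (z *+ M).
  rewrite mulrnA wE -[RHS](pf _ (upd (z *+ M') j w)); congr f.
  apply/rowP => i; rewrite !mxE !mulmxnE !mxE.
  by case: eqVneq => // _; rewrite !mulmxnE mulrnAC.
- have [->|ij] := eqVneq i j; first by apply: eq_qpoly qphi => y; rewrite upd_eq.
  by apply: eq_qpoly (qpoly_coord i) => y; rewrite upd_neq.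
- exact: qpolyD qf qg.
- exact: qpolyM qf qg.
Qed.

Lemma quasi_linear_const m : quasi_linear (fun=> m).
Proof.
split; first exact: qpoly_const.
by move=> M M0; exists 1%N => // y z; exists 0; rewrite mul0rn addr0.
Qed.

Lemma ev_intv_den (v : 'rV[rat]_N) : exists2 D, (0 < D)%N &
  forall z, ev v (intv R (z *+ D)) \is a Num.int.
Proof.
exists (\prod_i `|denq (v ord0 i)|)%N; first by rewrite prodn_gt0// => i; rewrite absz_gt0 denq_neq0.
move=> z; apply: rpred_sum => i _; rewrite (bigD1 i)//=.
rewrite !mxE mulmxnE mulnC mulrnA -[_ *+ `|_|]mulr_natr rmorphM /= mulrCA.
apply: rpredM; first by rewrite intr_int.
have -> : (`|denq (v ord0 i)|%N%:R : int)%:~R = ratr (denq (v ord0 i))%:~R :> R.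
  by rewrite ratr_int natz gtz0_abs// denq_gt0.
by rewrite -rmorphM /= -numqE ratr_int intr_int.
Qed.

Lemma intvD y z : intv R (y + z) = intv R y + intv R z.
Proof. by apply/rowP => i; rewrite !mxE rmorphD. Qed.

Lemma qpoly_ev (v : 'rV[rat]_N) : qpoly (fun y => ev v (intv R y)).
Proof.
rewrite /ev; apply: qpoly_sum => i _; apply: qpolyM; first exact: qpoly_const.
by apply: eq_qpoly (qpoly_coord i) => y; rewrite mxE.
Qed.

(** [top] is [ev v] plus a rounding error, and the error is periodic: a shift by a multiple of the
    common denominator changes [ev v] by an integer, which passes through floor and ceiling. *)
Lemma quasi_linear_top pos j v : quasi_linear (top R pos j v).
Proof.
have [D D0 DP] := ev_intv_den v.
have topD y z : (ev v (intv R z) \is a Num.int) ->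
    (top R pos j v (y + z))%:~R = (top R pos j v y)%:~R + ev v (intv R z).
  move=> zi; rewrite /top; case: ifP => _.
    by rewrite intvD evDr floorDrz// rmorphD /= (floorK zi).
  by rewrite intvD evDr ceilDrz// rmorphB rmorphD /= (ceilK zi) rmorphB addrAC.
split.
  apply: (@eq_qpoly (fun y => ev v (intv R y) +
      ((top R pos j v y)%:~R - ev v (intv R y)))).
    by move=> y; rewrite addrC subrK.
  apply: qpolyD; first exact: qpoly_ev.
  apply: (@qpoly_periodic _ D) => // y z.
  by rewrite topD// intvD evDr opprD addrACA subrr addr0.
move=> M M0; exists (D * M)%N; first by rewrite muln_gt0 D0.
move=> y z; exists (Num.floor (ev v (intv R (z *+ D)))).
apply: (@intr_inj R); rewrite rmorphD rmorphMn /= floorK//.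
have evM : ev v (intv R (z *+ (D * M))) = ev v (intv R (z *+ D)) *+ M.
  rewrite mulrnA -[RHS]mulr_natl -evZr; congr ev.
  by apply/rowP => i; rewrite !mxE mulmxnE rmorphMn mulr_natl.
by rewrite topD evM// rpredMn.
Qed.

(** * Discrete antiderivatives along one coordinate *)

Section Antidifference.
Variable j : 'I_N.

(** A normal form for summation over the [j]-th coordinate: powers of it, with coefficients that see
    it only modulo some [M]. *)
Inductive fiber_poly : ('rV[int]_N -> R) -> Prop :=
| fiber_monomial c (M k : nat) of (0 < M)%N & qpoly c &
    (forall y m q, c (upd y j (q * M%:Z + m)) = c (upd y j m)) :
    fiber_poly (fun y => c y * (y ord0 j)%:~R ^+ k)
| fiber_polyD f g of fiber_poly f & fiber_poly g : fiber_poly (fun y => f y + g y).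

Lemma fiber_polyM f g : fiber_poly f -> fiber_poly g ->
  fiber_poly (fun y => f y * g y).
Proof.
move=> ff; elim: ff g => {f} [c M k M0 qc pc|f1 f2 _ IH1 _ IH2] g fg; last first.
  rewrite (_ : (fun y => _) = fun y => f1 y * g y + f2 y * g y).
    exact: fiber_polyD (IH1 _ fg) (IH2 _ fg).
  by apply/funext => y; rewrite mulrDl.
elim: fg => {g} [c' M' k' M'0 qc' pc'|g1 g2 _ IH1 _ IH2]; last first.
  rewrite (_ : (fun y => _) = fun y =>
    c y * (y ord0 j)%:~R ^+ k * g1 y + c y * (y ord0 j)%:~R ^+ k * g2 y).
    exact: fiber_polyD IH1 IH2.
  by apply/funext => y; rewrite mulrDr.
rewrite (_ : (fun y => _) = fun y => c y * c' y * (y ord0 j)%:~R ^+ (k + k')).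
  apply: (@fiber_monomial (fun y => c y * c' y) (M * M')).
  - by rewrite muln_gt0 M0.
  - exact: qpolyM.
  - move=> y m q; rewrite PoszM; congr (_ * _).
      by rewrite [M%:Z * _]mulrC mulrA pc.
    by rewrite mulrA pc'.
by apply/funext => y; rewrite exprD mulrACA.
Qed.

Lemma qpoly_fiber f : qpoly f -> fiber_poly f.
Proof.
elim=> {f} [f M M0 pf|i|f g _ IHf _ IHg|f g _ IHf _ IHg].
- rewrite (_ : f = fun y => f y * (y ord0 j)%:~R ^+ 0).
    apply: (@fiber_monomial f M) => //; first exact: qpoly_periodic pf.
    move=> y m q; rewrite -[RHS](pf _ (upd 0 j q)); congr f.
    apply/rowP => i; rewrite !mxE mulmxnE !mxE.
    by case: eqVneq => _; rewrite ?mul0rn ?addr0// addrC -mulr_natr natz.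
  by apply/funext => y; rewrite mulr1.
- have [->|ij] := eqVneq i j.
    rewrite (_ : (fun y => _) = fun y => 1 * (y ord0 j)%:~R ^+ 1).
      by apply: (@fiber_monomial (fun=> 1) 1) => //; apply: qpoly_const.
    by apply/funext => y; rewrite mul1r.
  rewrite (_ : (fun y => _) = fun y => (y ord0 i)%:~R * (y ord0 j)%:~R ^+ 0).
    apply: (@fiber_monomial _ 1) => //; first exact: qpoly_coord.
    by move=> y m q; rewrite !upd_neq.
  by apply/funext => y; rewrite mulr1.
- exact: fiber_polyD.
- exact: fiber_polyM.
Qed.

Lemma divz_unique (m q s : int) (M : nat) :
  m = q * M%:Z + s -> 0 <= s -> s < M%:Z -> (m %/ M%:Z)%Z = q.
Proof.
move=> -> s0 sM; rewrite divzMDl ?divz_small ?addr0 ?s0//.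
by move: s0 sM; case: M => //= s0 /(le_lt_trans s0).
Qed.

Lemma qpoly_divz (r : int) (M : nat) : (0 < M)%N ->
  qpoly (fun y => ((y ord0 j - r) %/ M%:Z)%Z%:~R).
Proof.
move=> M0; have M0R : M%:R != 0 :> R by rewrite pnatr_eq0 -lt0n.
apply: (@eq_qpoly (fun y => M%:R^-1 * (y ord0 j)%:~R +
    (((y ord0 j - r) %/ M%:Z)%Z%:~R - M%:R^-1 * (y ord0 j)%:~R))).
  by move=> y; rewrite addrC subrK.
apply: qpolyD; first by apply: qpolyM; [apply: qpoly_const|apply: qpoly_coord].
apply: (@qpoly_periodic _ M) => // y z.
rewrite !mxE mulmxnE.
have -> : y ord0 j + z ord0 j *+ M - r = z ord0 j * M%:Z + (y ord0 j - r).
  by rewrite -mulr_natr natz; ring.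
rewrite divzMDl; last by rewrite eqz_nat -lt0n.
rewrite !rmorphD rmorphMn /= -[(z ord0 j)%:~R *+ M]mulr_natl mulrDr mulKf//.
by rewrite opprD [- _ - _]addrC addrACA subrr add0r.
Qed.

Lemma fiber_monomial_antidiff c (M k : nat) : (0 < M)%N -> qpoly c ->
  (forall y m q, c (upd y j (q * M%:Z + m)) = c (upd y j m)) ->
  exists2 G, qpoly G & forall y,
    G y - G (y - delta_mx ord0 j) = c y * (y ord0 j)%:~R ^+ k.
Proof.
move=> M0 qc pc.
(* On the residue class of [r] modulo [M] the coordinate is [M z + r], and the
   summand is a polynomial in [z]; [quo r] is constant on the gaps. *)
pose p (r : 'I_M) : {poly R} := (M%:R%:P * 'X + (r%:R)%:P) ^+ k.
have [P PE] := choice (fun r => poly_antidiff (p r)).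
pose quo (r : 'I_M) (m : int) : int := ((m - r%:Z) %/ M%:Z)%Z.
(* The [+ 1] turns the forward difference solved by [P r] into the backward difference required of
   [G]. *)
exists (fun y => \sum_(r <- enum 'I_M)
    c (upd y j r%:Z) * (P r).[(quo r (y ord0 j))%:~R + 1]).
  apply: qpoly_sum => r _; apply: qpolyM.
    exact: qpoly_upd (quasi_linear_const _).
  apply: qpoly_horner; apply: qpolyD; last exact: qpoly_const.
  exact: qpoly_divz.
move=> y; rewrite -sumrB big_enum /=.
set m := y ord0 j.
have r0M : (`|(m %% M%:Z)%Z| < M)%N.
  by rewrite -ltz_nat gez0_abs ?modz_ge0 ?ltz_pmod// eqz_nat -lt0n.
pose r0 := Ordinal r0M.
have r0E : r0%:Z = (m %% M%:Z)%Z by rewrite /= gez0_abs// modz_ge0// eqz_nat -lt0n.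
have mE : m = (m %/ M%:Z)%Z * M%:Z + r0%:Z by rewrite r0E -divz_eq.
set z := (m %/ M%:Z)%Z in mE.
have updE r : upd (y - delta_mx ord0 j) j r%:Z = upd y j r%:Z.
  apply/rowP => i; rewrite !mxE; case: eqVneq => //= ij.
  by rewrite subr0.
have yj : (y - delta_mx ord0 j) ord0 j = m - 1 by rewrite !mxE !eqxx.
rewrite yj (bigD1 r0)//= big1 ?addr0 => [|r rr0].
  rewrite updE -mulrBr.
  have -> : quo r0 m = z by apply: (@divz_unique _ _ 0); lia.
  have -> : quo r0 (m - 1) = z - 1 by apply: (@divz_unique _ _ (M%:Z - 1)); lia.
  rewrite rmorphB /= subrK PE /p horner_exp hornerD hornerM !hornerC hornerX.
  congr (_ * _ ^+ _).
    rewrite -(pc y r0 z) -mE; congr c.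
    by apply/rowP => i; rewrite mxE; case: eqVneq => // ->.
  by rewrite [in RHS]mE rmorphD rmorphM /= mulrC.
have rr : r%:Z <> r0%:Z by move=> [] e; move/eqP: rr0; apply; apply: val_inj.
have rM := ltn_ord r.
rewrite updE -mulrBr (_ : quo r (m - 1) = quo r m) ?subrr ?mulr0//.
(* When [m] is not congruent to [r], the quotient is the same at [m - 1] and at [m]: it is [z] if
   [r] is below the residue [r0] of [m], and [z - 1] if it is above. *)
have [lr|gr] := ltP r%:Z r0%:Z.
  by rewrite /quo (@divz_unique _ z (r0%:Z - r%:Z - 1)) ?(@divz_unique (m - r%:Z) z (r0%:Z - r%:Z))//; lia.
rewrite /quo (@divz_unique _ (z - 1) (r0%:Z - r%:Z - 1 + M%:Z)); try by lia.
by rewrite (@divz_unique (m - r%:Z) (z - 1) (r0%:Z - r%:Z + M%:Z)) //; lia.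
Qed.

Lemma qpoly_antidiff f : qpoly f ->
  exists2 G, qpoly G & forall y, G y - G (y - delta_mx ord0 j) = f y.
Proof.
move=> /qpoly_fiber; elim=> {f} [c M k M0 qc pc|f g _ [F qF FE] _ [G qG GE]].
  exact: fiber_monomial_antidiff pc.
exists (fun y => F y + G y); first exact: qpolyD.
by move=> y; rewrite opprD addrACA FE GE.
Qed.

End Antidifference.

End QuasiPolynomialFunctions.

(** * Reciprocity for sums over lattice points *)

Section LatticeSums.
Variables (R : archiRealFieldType) (n : nat).
Implicit Types (pos : pred 'rV[rat]_n.+1) (L : seq 'rV[rat]_n.+1).
Implicit Types (y z : 'rV[int]_n.+1) (u v l : 'rV[rat]_n.+1).

Definition axis (t : int) : 'rV[int]_n.+1 := t *: delta_mx ord0 ord0.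

(** The head of the list varies innermost, so the variables are eliminated in the order of the
    list. *)
Fixpoint box_points (B : nat) (js : seq 'I_n.+1) y : seq 'rV[int]_n.+1 :=
  if js is j :: js' then [seq upd z j m | z <- box_points B js' y, m <- irange B]
  else [:: y].

Lemma box_points_cons B j js y : box_points B (j :: js) y =
  [seq upd z j m | z <- box_points B js y, m <- irange B].
Proof. by []. Qed.

Lemma mem_irange B (m : int) : (m \in irange B) = (`|m| <= B%:Z).
Proof.
apply/mapP/idP => [[k]|mB]; first by rewrite mem_iota add0n => kB ->; lia.
by exists (absz (m + B%:Z)); [rewrite mem_iota|]; lia.
Qed.

Lemma irange_uniq B : uniq (irange B).
Proof. by rewrite map_inj_uniq ?iota_uniq// => a b; lia. Qed.

Lemma box_points_out B js y z i :
  z \in box_points B js y -> i \notin js -> z ord0 i = y ord0 i.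
Proof.
elim: js z => [|j js IH] z; first by rewrite inE => /eqP ->.
rewrite box_points_cons; case/allpairsP=> -[x m] /= [xb _ ->]; rewrite inE negb_or => /andP[ij ijs].
by rewrite upd_neq// IH.
Qed.

Lemma mem_box_points B js y z : uniq js ->
  (z \in box_points B js y) =
  [forall i, if i \in js then `|z ord0 i| <= B%:Z else z ord0 i == y ord0 i].
Proof.
elim: js z => [|j js IH] z.
  move=> _; rewrite inE; apply/eqP/forallP => [-> i //|zy].
  by apply/rowP => i; apply/eqP/zy.
rewrite box_points_cons => /andP[jjs /IH {}IH]; apply/allpairsP/forallP => [[[x m] /= [xb mB ->]] i|zP].
  move: xb; rewrite IH => /forallP/(_ i); rewrite inE mxE.
  by case: (eqVneq i j) => [-> _|_ //]; rewrite -mem_irange.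
exists (upd z j (y ord0 j), z ord0 j); split => /=.
- rewrite IH; apply/forallP => i; have := zP i; rewrite inE mxE.
  by case: (eqVneq i j) => [->|_ //]; rewrite (negPf jjs).
- by rewrite mem_irange; have := zP j; rewrite mem_head.
- by apply/rowP => i; rewrite !mxE; case: eqVneq => // ->.
Qed.

Lemma box_points_uniq B js y : uniq js -> uniq (box_points B js y).
Proof.
elim: js => // j js IH; rewrite box_points_cons => /andP[jjs /IH ubp].
apply: allpairs_uniq => //; first exact: irange_uniq.
move=> p q pb qb; case/(@allpairsP _ _ _ pair): pb => -[x m] [xb _ ->].
case/(@allpairsP _ _ _ pair): qb => -[x1 m1] [xb1 _ ->] /= e; rewrite /= in xb xb1.
have em : m = m1 by rewrite -(upd_eq x j m) e upd_eq.
congr (_, _) => //; apply/rowP => i; have [->|ij] := eqVneq i j.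
  by rewrite (box_points_out xb)// (box_points_out xb1).
by rewrite -(upd_neq x m ij) e upd_neq.
Qed.

Lemma intv_axis t : intv R (axis t) = t%:~R *: delta_mx ord0 ord0.
Proof. by apply/rowP => i; rewrite !mxE rmorphM /=; case: eqP. Qed.

(** The right side mentions neither [pos] nor [t]. This is where the sums for an order and for its
    reverse meet once all variables are eliminated. *)
Lemma sat_axis pos l t : form_order pos -> 0 < t ->
  (forall i, i != ord0 -> l ord0 i = 0) ->
  sat R pos (axis t) l = (0 < l ord0 ord0).
Proof.
case=> p0 _ _ _ t0 l0; rewrite /sat /lex intv_axis evZr ev_delta.
have tR : 0 < t%:~R :> R by rewrite ltr0z.
rewrite pmulr_rgt0// ltr0q mulf_eq0 (gt_eqF tR) /= fmorph_eq0.
case: (eqVneq (l ord0 ord0) 0) => [l00|_]; last by rewrite orbF.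
rewrite (_ : l = 0) ?(negPf p0) ?andbF ?orbF//.
by apply/rowP => i; rewrite [RHS]mxE; have [->|/l0] := eqVneq i ord0.
Qed.

(** Negation exchanges floor and ceiling, and reversing the order exchanges the two cases of [top].
    The remaining [- 1] reflects that [top] is inclusive as an upper end and exclusive as a lower
    end. *)
Lemma top_opp pos j v y : form_order pos -> v ord0 j = 0 ->
  top R pos j v (- y) = - top R (opp_order pos) j v y - 1.
Proof.
move=> op vj; rewrite /top /opp_order (form_order_neg op); last first.
  by apply/eqP => /rowP/(_ j)/eqP; rewrite !mxE vj !eqxx sub0r oppr_eq0 oner_eq0.
rewrite intvN evNr; case: (pos _) => /=.
  by rewrite floorNceil opprK opprB addrAC subrr add0r.
by rewrite ceilNfloor opprK.
Qed.

Lemma top_axis pos j c y (M : nat) : c = M%:Z \/ c = - M%:Z ->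
  c * y ord0 ord0 - 1 <=
    top R pos j (c%:~R *: delta_mx ord0 ord0) y <= c * y ord0 ord0.
Proof.
move=> _; rewrite /top evZl ev_coord mxE ratr_int -rmorphM /=.
by case: ifP => _; rewrite ?intrKfloor ?intrKceil; lia.
Qed.

(** Induction with [L] and [f] general, since each step replaces them by a piece and by a difference
    of antiderivatives. The box forms give every variable a bound on either side at each stage, and
    [M%:Z * t <= B%:Z] keeps the finite box from cutting the ranges. *)
Theorem lattice_sum pos (M : nat) (js : seq 'I_n.+1) :
  form_order pos -> uniq js -> ord0 \notin js ->
  forall L f, @qpoly R _ f ->
  (forall l, l \in L -> forall i, i \notin ord0 :: js -> l ord0 i = 0) ->
  (forall j, j \in js ->
     M%:R *: delta_mx ord0 ord0 - delta_mx ord0 j \in L /\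
     M%:R *: delta_mx ord0 ord0 + delta_mx ord0 j \in L) ->
  exists2 f0, qpoly f0 & forall t (B : nat), 0 < t -> M%:Z * t <= B%:Z ->
    \sum_(z <- box_points B js (axis t)) (all (sat R pos z) L)%:R * f z =
      f0 (axis t) /\
    \sum_(z <- box_points B js (axis t))
        (all (sat R (opp_order pos) z) L)%:R * f (- z) =
      (-1) ^+ size js * f0 (- axis t).
Proof.
move=> op; have op' := opp_form_order op.
elim: js => [|j js IH].
  move=> _ _ L f qf supL _.
  exists (if all (fun l => 0 < l ord0 ord0) L then f else fun=> 0).
    by case: ifP => // _; apply: qpoly_const.
  move=> t B t0 _; rewrite !big_seq1 mul1r.
  have satE p : form_order p ->
      all (sat R p (axis t)) L = all (fun l => 0 < l ord0 ord0) L.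
    move=> fp; apply: eq_in_all => l lL; apply: sat_axis => // i i0.
    by apply: supL => //; rewrite inE.
  by rewrite !satE//; case: (all _ L); rewrite ?mul1r ?mul0r.
rewrite cons_uniq => /andP[jjs ujs]; rewrite inE negb_or => /andP[j0 js0] L f qf supL boxL.
have [G qG GE] := qpoly_antidiff j qf.
have [MupL MloL] := boxL j (mem_head _ _).
have e0j : (delta_mx ord0 ord0 : 'rV[rat]_n.+1) ord0 j = 0.
  by rewrite mxE eqxx eq_sym (negPf j0).
have MupP : M%:Z%:~R *: delta_mx ord0 ord0 \in ups j L.
  rewrite mem_undup; apply/mapP.
  exists (M%:R *: delta_mx ord0 ord0 - delta_mx ord0 j).
    by rewrite mem_filter MupL andbT mxE mxE e0j !mxE !eqxx mulr0.
  rewrite /root_form [X in X^-1](_ : _ = -1); last by rewrite mxE mxE e0j !mxE !eqxx mulr0 add0r.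
  by rewrite invrN1 scaleN1r opprK addrC subrK.
have MloP : (- M%:Z)%:~R *: delta_mx ord0 ord0 \in lows j L.
  rewrite mem_undup; apply/mapP.
  exists (M%:R *: delta_mx ord0 ord0 + delta_mx ord0 j).
    by rewrite mem_filter MloL andbT mxE mxE e0j !mxE !eqxx mulr0 add0r.
  rewrite /root_form [X in X^-1](_ : _ = 1); last by rewrite mxE mxE e0j !mxE !eqxx mulr0 add0r.
  by rewrite invr1 scale1r opprD addrCA subrr addr0 rmorphN scaleNr.
pose H v u y := G (upd y j (top R pos j u y)) - G (upd y j (top R pos j v y)).
have qH v u : qpoly (H v u).
  by apply: qpolyB; apply: qpoly_upd => //; apply: quasi_linear_top.
have piece_sup v u l : v \in lows j L -> u \in ups j L -> l \in piece j L v u ->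
    forall i, i \notin ord0 :: js -> l ord0 i = 0.
  move=> vL uL; have root0 w : w \in lows j L \/ w \in ups j L ->
      forall i, i \notin ord0 :: js -> w ord0 i = 0.
    move=> wL i iN; have [->|ij] := eqVneq i j.
      by case: wL => [/lows0|/ups0].
    have [k kL ->] : exists2 k, k \in L & w = root_form j k.
      by case: wL; rewrite mem_undup => /mapP[k]; rewrite mem_filter => /andP[_ kL] ->; exists k.
    rewrite !mxE (negPf ij) andbF (supL k kL i) ?mulr0 ?subrr//.
    by apply: contra iN; rewrite !inE (negPf ij).
  rewrite !mem_cat inE => /or4P[/mapP[w]|/mapP[w]|/eqP ->|].
  - rewrite mem_filter => /andP[_ wL] -> i iN.
    by rewrite mxE mxE !root0 ?subrr//; left.
  - rewrite mem_filter => /andP[_ wL] -> i iN.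
    by rewrite mxE mxE !root0 ?subrr//; right.
  - by move=> i iN; rewrite mxE mxE !root0 ?subrr//; [left|right].
  - rewrite mem_filter => /andP[/eqP lj lL] i iN; have [-> //|ij] := eqVneq i j.
    by apply: supL => //; apply: contra iN; rewrite !inE (negPf ij).
have piece_box v u k : k \in js ->
    M%:R *: delta_mx ord0 ord0 - delta_mx ord0 k \in piece j L v u /\
    M%:R *: delta_mx ord0 ord0 + delta_mx ord0 k \in piece j L v u.
  move=> kjs; have [|b1 b2] := boxL k; first by rewrite inE kjs orbT.
  have jk : (j == k) = false by apply: contraNF jjs => /eqP ->.
  rewrite !mem_cat !inE !mem_filter b1 b2 !mxE jk [j == ord0]eq_sym (negPf j0).
  by rewrite !andbF mulr0 subr0 eqxx !orbT.
(* Pairs that are not a lower and an upper root get the function 0, so that a choice over all pairs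
   is possible. *)
have IHp (p : 'rV[rat]_n.+1 * 'rV[rat]_n.+1) : exists f0, qpoly f0 /\
   (p.1 \in lows j L -> p.2 \in ups j L ->
    forall t (B : nat), 0 < t -> M%:Z * t <= B%:Z ->
    \sum_(z <- box_points B js (axis t))
        (all (sat R pos z) (piece j L p.1 p.2))%:R * H p.1 p.2 z =
      f0 (axis t) /\
    \sum_(z <- box_points B js (axis t))
        (all (sat R (opp_order pos) z) (piece j L p.1 p.2))%:R * H p.1 p.2 (- z) =
      (-1) ^+ size js * f0 (- axis t)).
  case: p => v u /=.
  have [vL|_] := boolP (v \in lows j L); last first.
    by exists (fun=> 0); split=> //; apply: qpoly_const.
  have [uL|_] := boolP (u \in ups j L); last first.
    by exists (fun=> 0); split=> //; apply: qpoly_const.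
  have [f0 qf0 f0E] := IH ujs js0 _ _ (qH v u) (fun l => piece_sup v u l vL uL) (piece_box v u).
  by exists f0.
have [F FP] := choice IHp.
exists (fun y => \sum_(v <- lows j L) \sum_(u <- ups j L) F (v, u) y).
  by apply: qpoly_sum => v _; apply: qpoly_sum => u _; case: (FP (v, u)).
move=> t B t0 MtB.
have bounds p z : z \in box_points B js (axis t) ->
   (exists2 v, v \in lows j L & - B%:Z - 1 <= top R p j v z) /\
   (exists2 u, u \in ups j L & top R p j u z <= B%:Z).
  move=> zb; have z0 : z ord0 ord0 = t.
    by rewrite (box_points_out zb)// !mxE !eqxx mulr1.
  split; [exists ((- M%:Z)%:~R *: delta_mx ord0 ord0) => //|
          exists (M%:Z%:~R *: delta_mx ord0 ord0) => //].
    have /andP[h _] := @top_axis p j _ z M (or_intror erefl).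
    by apply: le_trans h; rewrite z0; lia.
  have /andP[_ h] := @top_axis p j _ z M (or_introl erefl).
  by apply: le_trans h _; rewrite z0.
split.
  rewrite box_points_cons big_allpairs_dep /=; under eq_big_seq => z zb.
    have [lo up] := bounds pos z zb.
    rewrite (eliminate op GE lo up); over.
  rewrite exchange_big; apply: eq_big_seq => v vL /=.
  rewrite exchange_big; apply: eq_big_seq => u uL /=.
  by have [_ /(_ vL uL t B t0 MtB)[]] := FP (v, u).
(* An antiderivative of [f (- y)]. Its shift by [ej] absorbs the [- 1] of [top_opp], so that [G'] at
   the reversed bounds is minus [G] at the original ones: the sign of this variable. *)
pose G' y := - G (- y - delta_mx ord0 j).
have GE' y : G' y - G' (y - delta_mx ord0 j) = f (- y).
  by rewrite /G' opprK opprB addrC [_ - y]addrC addrK GE.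
rewrite box_points_cons big_allpairs_dep /=; under eq_big_seq => z zb.
  have [lo up] := bounds (opp_order pos) z zb.
  rewrite (eliminate op' GE' lo up); over.
rewrite exchange_big mulr_sumr; apply: eq_big_seq => v vL /=.
rewrite exchange_big mulr_sumr; apply: eq_big_seq => u uL /=.
have [_ /(_ vL uL t B t0 MtB)[_ E]] := FP (v, u).
rewrite exprS -mulrA -E mulN1r -sumrN; apply: eq_bigr => z _.
rewrite -mulrN; congr (_ * _).
have Gtop (w : 'rV[rat]_n.+1) : w ord0 j = 0 -> G' (upd z j (top R (opp_order pos) j w z)) =
    - G (upd (- z) j (top R pos j w (- z))).
  by move=> wj; rewrite /G' updN upd_sub_delta top_opp.
by rewrite !Gtop ?(lows0 vL) ?(ups0 uL)// /H opprB opprK addrC.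
Qed.

End LatticeSums.

(** * Half-spaces of a finitely generated cone *)

Section FiniteCones.
Variables (R : archiRealFieldType) (N : nat).
Implicit Types (x y : 'rV[R]_N) (v l : 'rV[rat]_N) (L vs : seq 'rV[rat]_N).

Definition ratv v : 'rV[R]_N := map_mx ratr v.

Definition evq l v : rat := \sum_i l ord0 i * v ord0 i.

Lemma ev_ratv l v : ev l (ratv v) = ratr (evq l v).
Proof. by rewrite rmorph_sum; apply: eq_bigr => i _; rewrite mxE rmorphM. Qed.

Fixpoint in_cone vs x : Prop :=
  if vs is v :: vs' then exists2 s, 0 <= s & in_cone vs' (x - s *: ratv v)
  else x = 0.

Lemma in_cone_map (I : eqType) (w : I -> 'rV[rat]_N) (s : seq I) x : uniq s ->
  in_cone (map w s) x <->
  exists2 c : I -> R, (forall i, 0 <= c i) & x = \sum_(i <- s) c i *: ratv (w i).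
Proof.
elim: s x => [|i s IH] x /=.
  move=> _; split=> [->|[c _ ->]]; last by rewrite big_nil.
  by exists (fun=> 0); rewrite ?big_nil.
case/andP=> iNs /IH {}IH; split.
  case=> r r0 /IH [c c0 xE].
  exists (fun k => if k == i then r else c k) => [k|]; first by case: ifP.
  rewrite big_cons eqxx -[LHS](subrK (r *: ratv (w i))) xE addrC; congr (_ + _).
  by apply: eq_big_seq => k ks; case: eqP => // ki; rewrite -ki ks in iNs.
case=> c c0 ->; exists (c i) => //; apply/IH; exists c => //.
by rewrite big_cons addrC addKr.
Qed.

(* One step of the double description method: the forms that cut out the cone
   generated by [v] and the cone cut out by [L]. *)
Definition cone_step v L :=
  [seq l <- L | 0 <= evq l v] ++
  [seq evq a v *: b - evq b v *: a | a <- [seq l <- L | 0 < evq l v],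
                                     b <- [seq l <- L | evq l v < 0]].

(** For fixed [x] each form bounds [s] from above, from below or not at all, by the sign of
    [evq l v]. The forms kept say that the upper bounds are nonnegative, the combinations that they
    are at least the lower bounds. *)
Lemma cone_stepP v L x :
  (forall l, l \in cone_step v L -> 0 <= ev l x) <->
  exists2 s, 0 <= s & forall l, l \in L -> 0 <= ev l (x - s *: ratv v).
Proof.
have evE l s : ev l (x - s *: ratv v) = ev l x - s * ratr (evq l v).
  by rewrite evBr evZr ev_ratv.
split=> [H|[s s0 H] l]; last first.
  rewrite mem_cat => /orP[|/allpairsP[[a b] /= []]].
    rewrite mem_filter => /andP[lv /H]; rewrite evE subr_ge0.
    by apply: le_trans; rewrite mulr_ge0// ler0q.
  rewrite !mem_filter => /andP[av /H aL] /andP[bv /H bL] ->.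
  move: aL bL; rewrite !evE evBl !evZl.
  have : 0 < ratr (evq a v) :> R by rewrite ltr0q.
  have : ratr (evq b v) < 0 :> R by rewrite ltrq0.
  move: (ratr (evq a v)) (ratr (evq b v)) => A B B0 A0 h1 h2.
  have := mulr_ge0 (ltW A0) h2; have : 0 <= - B by lra.
  by move/mulr_ge0 => /(_ _ h1); lra.
(* The least admissible [s] is the largest of the lower bounds. *)
pose bs := [seq l <- L | evq l v < 0].
have [s s0 [sb sw]] : exists2 s, 0 <= s &
    (forall b, b \in bs -> ev b x / ratr (evq b v) <= s) /\
    (s = 0 \/ exists2 b, b \in bs & s = ev b x / ratr (evq b v)).
  elim: bs => [|b bs [s s0 [sb sw]]]; first by exists 0 => //; split=> //; left.
  have [le|lt] := leP (ev b x / ratr (evq b v)) s.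
    exists s => //; split=> [c|]; first by rewrite inE => /orP[/eqP->|/sb].
    by case: sw => [|[c cs sE]]; [left|right; exists c; rewrite ?inE ?cs ?orbT].
  exists (ev b x / ratr (evq b v)); first exact: le_trans s0 (ltW lt).
  split=> [c|]; last by right; exists b; rewrite ?mem_head.
  by rewrite inE => /orP[/eqP->//|/sb cs]; apply: le_trans cs (ltW lt).
exists s => // l lL; rewrite evE subr_ge0.
have [lv|lv|lv] := ltrgtP (evq l v) 0.
- have lR : ratr (evq l v) < 0 :> R by rewrite ltrq0.
  by rewrite -ler_ndivrMr// sb// mem_filter lv.
- have lR : 0 < ratr (evq l v) :> R by rewrite ltr0q.
  case: sw => [->|[b bbs ->]].
    by rewrite mul0r; apply: H; rewrite mem_cat mem_filter (ltW lv) lL.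
  have := bbs; rewrite mem_filter => /andP[bv bL].
  have bR : ratr (evq b v) < 0 :> R by rewrite ltrq0.
  have : 0 <= ev (evq l v *: b - evq b v *: l) x.
    apply: H; rewrite mem_cat; apply/orP; right; apply/allpairsP.
    by exists (l, b); rewrite /= !mem_filter ?lv ?bv ?lL ?bL.
  rewrite evBl !evZl => h; rewrite mulrAC ler_ndivrMr//.
  by rewrite -subr_ge0 [ev l x * _]mulrC [ev b x * _]mulrC.
- by rewrite lv rmorph0 mulr0; apply: H; rewrite mem_cat mem_filter lv lexx lL.
Qed.

(** The Weyl half of the Minkowski-Weyl theorem. The forms stay rational although [x] is real; form
    orders and common denominators rely on this. *)
Lemma cone_halfspaces vs : exists L, forall x,
  in_cone vs x <-> forall l, l \in L -> 0 <= ev l x.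
Proof.
elim: vs => [|v vs [L LP]].
  exists ([seq delta_mx ord0 i | i <- enum 'I_N] ++
          [seq - delta_mx ord0 i | i <- enum 'I_N]) => x /=; split=> [-> l _|H].
    by rewrite -(scale0r 0) evZr mul0r.
  apply/rowP => i; rewrite mxE -ev_coord; apply/eqP; rewrite eq_le -oppr_ge0 -evNl.
  by rewrite !H// mem_cat; apply/orP; [left|right]; apply/mapP; exists i;
    rewrite ?mem_enum.
exists (cone_step v L) => x /=; rewrite cone_stepP.
by split=> -[s s0 /LP sP]; exists s => //; apply/LP.
Qed.

End FiniteCones.

(** * Facets *)

Import numFieldNormedType.Exports.
Local Open Scope classical_set_scope.
Local Open Scope ring_scope.

Section Homogenization.
Variables (R : realType) (n : nat).
Implicit Types (s t : R) (x y : 'rV[R]_n) (l : 'rV[rat]_n.+1).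

Definition homog (T : Type) (s : T) (z : 'rV[T]_n) : 'rV[T]_n.+1 :=
  \row_i oapp (z ord0) s (unlift ord0 i).

Lemma homog0 (T : Type) (s : T) (z : 'rV[T]_n) i : homog s z i ord0 = s.
Proof. by rewrite mxE unlift_none. Qed.

Lemma homog_lift (T : Type) (s : T) (z : 'rV[T]_n) i j :
  homog s z i (lift ord0 j) = z ord0 j.
Proof. by rewrite mxE liftK. Qed.

Lemma homogD s t x y : homog (s + t) (x + y) = homog s x + homog t y.
Proof. by apply/rowP => i; rewrite !mxE; case: unliftP => //= j _; rewrite mxE. Qed.

Lemma homogZ c s x : homog (c * s) (c *: x) = c *: homog s x.
Proof. by apply/rowP => i; rewrite !mxE; case: unliftP => //= j _; rewrite mxE. Qed.

Lemma ev_homogD l s t x y : ev l (homog (s + t) (x + y)) = ev l (homog s x) + ev l (homog t y).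
Proof. by rewrite homogD evDr. Qed.

Lemma ev_homogZ l c s x : ev l (homog (c * s) (c *: x)) = c * ev l (homog s x).
Proof. by rewrite homogZ evZr. Qed.

Definition normal l : 'rV[R]_n := \row_j ratr (l ord0 (lift ord0 j)).

Lemma ev_homog l s x : ev l (homog s x) = ratr (l ord0 ord0) * s + dotp (normal l) x.
Proof.
rewrite /ev big_ord_recl homog0; congr (_ + _).
by apply: eq_bigr => j _; rewrite homog_lift mxE.
Qed.

Lemma ev_homog0 l x : ev l (homog 0 x) = dotp (normal l) x.
Proof. by rewrite ev_homog mulr0 add0r. Qed.

Lemma ev_homogB l s t x y : ev l (homog (s - t) (x - y)) = ev l (homog s x) - ev l (homog t y).
Proof. by rewrite ev_homogD -[- t]mulN1r -[- y]scaleN1r ev_homogZ mulN1r. Qed.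

Lemma dotp_normalB l x y :
  dotp (normal l) (x - y) = ev l (homog 1 x) - ev l (homog 1 y).
Proof. by rewrite -ev_homogB subrr ev_homog0. Qed.

End Homogenization.

Section Perturbation.
Variables (R : realType) (n : nat).

Lemma perturb (s : seq (R * R)) : (forall p, p \in s -> 0 < p.1) ->
  exists2 e, 0 < e & forall d, 0 < d -> d <= e ->
    forall p, p \in s -> 0 < p.1 + d * p.2.
Proof.
elim: s => [|[a b] s IH] sP; first by exists 1.
have [p ps|e e0 eP] := IH; first by apply: sP; rewrite inE ps orbT.
have a0 : 0 < a by apply: (sP (a, b)); rewrite mem_head.
have b1 : 0 < 1 + `|b| by rewrite ltr_pwDl.
exists (Num.min e (a / (1 + `|b|))); first by rewrite lt_min e0 divr_gt0.
move=> d d0; rewrite le_min ler_pdivlMr// => /andP[de dab] p.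
rewrite inE => /orP[/eqP->/=|]; last exact: eP.
have := ler_norm (- b); rewrite normrN => bb.
have : d * (- b) <= d * `|b| by rewrite ler_wpM2l// ltW.
by lra.
Qed.

End Perturbation.

Section AffineSets.
Variables (R : realType) (n k : nat).
Implicit Types (S : set 'rV[R]_n) (D : 'M[R]_(k, n)).

(** Differences in [S] bound the dimension from above; small steps from [p] along a row basis of [D]
    bound it from below. *)
Lemma dimension_eq S D p : S p -> (forall x y, S x -> S y -> (x - y <= D)%MS) ->
  (forall m (W : 'M[R]_(m, n)), (W <= D)%MS ->
     exists2 e, 0 < e & forall i, S (p + e *: row i W)) ->
  dimension S = \rank D.
Proof.
move=> Sp SD pert; apply/eqP; rewrite eqn_leq; apply/andP; split.
  apply/bigmax_leqP => r /asboolP[x0 [V [Sx0 SV]]] /eqP <-.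
  apply/mxrankS/row_subP => i; rewrite rowK; exact: SD.
have rn : (\rank D < n.+1)%N by rewrite ltnS rank_leq_col.
apply: (@leq_bigmax_cond _ _ (fun k : 'I_n.+1 => k : nat) (Ordinal rn)).
apply/asboolP.
have [|e e0 eP] := pert _ (row_base D); first by rewrite eq_row_base.
exists p, (\matrix_i (p + e *: row i (row_base D))); split=> // [i|].
  by rewrite rowK.
rewrite (_ : \matrix_i _ = e *: row_base D).
  by rewrite /row_free mxrank_scale_nz ?lt0r_neq0//; apply: row_base_free.
by apply/row_matrixP => i; rewrite !rowK addrC addKr linearZ.
Qed.

End AffineSets.

Section FacetPresentation.
Variables (R : realType) (n k : nat).
Implicit Types (P : set 'rV[R]_n) (L : seq 'rV[rat]_n.+1).

(** [q] is a relative interior point. Irredundancy is stored as a witness: a point of the affine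
    hull that violates [l] and no other form. *)
Record facet_presentation P (p0 : 'rV[R]_n) (D : 'M[R]_(k, n)) L (q : 'rV[R]_n) :
    Prop := FacetPresentation {
  fp_mem : forall x, P x <->
    (x - p0 <= D)%MS /\ forall l, l \in L -> 0 <= ev l (homog 1 x);
  fp_aff : (q - p0 <= D)%MS;
  fp_pos : forall l, l \in L -> 0 < ev l (homog 1 q);
  fp_min : forall l, l \in L -> exists z, [/\ (z - p0 <= D)%MS,
    forall l', l' \in L -> l' != l -> 0 <= ev l' (homog 1 z) & ev l (homog 1 z) < 0] }.

Variables (P : set 'rV[R]_n) (p0 : 'rV[R]_n) (D : 'M[R]_(k, n)).
Variables (L : seq 'rV[rat]_n.+1) (q : 'rV[R]_n).
Hypothesis FP : facet_presentation P p0 D L q.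

Lemma mem_aff_diff x y : (x - p0 <= D)%MS -> (y - p0 <= D)%MS -> (x - y <= D)%MS.
Proof.
move=> xD yD; have -> : x - y = (x - p0) + -1 *: (y - p0).
  by rewrite scaleN1r opprB addrA subrK.
by rewrite addmx_sub// scalemx_sub.
Qed.

Lemma fp_perturb (L' : seq 'rV[rat]_n.+1) t x m (W : 'M[R]_(m, n)) :
  (forall l, l \in L' -> 0 < ev l (homog t x)) ->
  exists2 e, 0 < e &
    forall i l, l \in L' -> 0 < ev l (homog t (x + e *: row i W)).
Proof.
move=> xL; pose s := [seq (ev l (homog t x), ev l (homog 0 (row i W))) |
  l <- L', i <- enum 'I_m].
have [p|e e0 eP] := @perturb R s.
  by move=> /allpairsP[[l i] /= [lL _ ->]]; apply: xL.
exists e => // i l lL.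
rewrite -[t]addr0 -[in X in t + X](mulr0 e) ev_homogD ev_homogZ.
apply: (eP e e0 (lexx _) (ev l (homog t x), ev l (homog 0 (row i W)))).
by apply/allpairsP; exists (l, i); rewrite mem_enum.
Qed.

Lemma fp_dimension : dimension P = \rank D.
Proof.
apply: (@dimension_eq _ _ _ P D q).
- by apply/(fp_mem FP); split=> [|l lL]; [exact: (fp_aff FP)|exact/ltW/(fp_pos FP)].
- by move=> x y /(fp_mem FP)[xD _] /(fp_mem FP)[yD _]; apply: mem_aff_diff.
- move=> m W WD; have [e e0 eP] := fp_perturb W (fp_pos FP).
  exists e => // i; apply/(fp_mem FP); split=> [|l lL]; last exact/ltW/eP.
  rewrite addrAC addmx_sub ?(fp_aff FP)// scalemx_sub//.
  exact: submx_trans (row_sub _ _) WD.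
Qed.

(** The segment from the witness [z] to [q] meets the hyperplane of [l] in a point [p] where all
    other forms are positive. From [p] every direction of [D] killed by the normal is free, and
    [q - z] shows that these have codimension one in [D]. *)
Lemma fp_facet l : l \in L -> facet P (P `&` [set x | ev l (homog 1 x) = 0]).
Proof.
move=> lL; have [z [zD zL zl]] := fp_min FP lL.
have ql := fp_pos FP lL; have qD := fp_aff FP.
pose a := ev l (homog 1 q); pose b := ev l (homog 1 z); pose th := a / (a - b).
have ab : 0 < a - b by rewrite subr_gt0 (lt_trans zl).
have th0 : 0 < th by rewrite divr_gt0.
have th1 : th < 1 by rewrite ltr_pdivrMr// mul1r ltrBrDr gtrDl.
pose p := th *: z + (1 - th) *: q.
have evp l' : ev l' (homog 1 p) = th * ev l' (homog 1 z) + (1 - th) * ev l' (homog 1 q).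
  by rewrite -!ev_homogZ -ev_homogD -/p !mulr1 addrC subrK.
have pl : ev l (homog 1 p) = 0.
  rewrite evp -/a -/b /th; field; exact: lt0r_neq0.
have pL l' : l' \in L -> l' != l -> 0 < ev l' (homog 1 p).
  move=> l'L nl; rewrite evp; apply: ltr_wpDl.
    exact: mulr_ge0 (ltW th0) (zL _ l'L nl).
  by apply: mulr_gt0; [rewrite subr_gt0|exact: (fp_pos FP)].
have pD : (p - p0 <= D)%MS.
  have -> : p - p0 = th *: (z - p0) + (1 - th) *: (q - p0).
    by rewrite !scalerBr addrACA -opprD -scalerDl [th + _]addrC subrK scale1r.
  by rewrite addmx_sub// scalemx_sub.
have Pp : P p.
  apply/(fp_mem FP); split=> // l' l'L; have [->|/pL] := eqVneq l' l.
    by rewrite pl.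
  by move=> /(_ l'L)/ltW.
have mulc x : x *m (normal R l)^T = (dotp (normal R l) x)%:M.
  apply/rowP => i; rewrite !mxE ord1 eqxx mulr1n.
  by apply: eq_bigr => j _; rewrite !mxE mulrC.
split.
- exists (- normal R l), (ratr (l ord0 ord0)).
  have dotE x : dotp (- normal R l) x = ratr (l ord0 ord0) - ev l (homog 1 x).
    rewrite ev_homog mulr1 opprD addrA subrr add0r -sumrN.
    by apply: eq_bigr => i _; rewrite mxE mulNr.
  split=> [x /(fp_mem FP)[_ /(_ l lL) xl]|].
    by rewrite dotE gerBl.
  apply/seteqP; split=> x /= [Px].
    by move=> xl; split=> //; rewrite dotE xl subr0.
  rewrite dotE => /eqP; rewrite subr_eq addrC -subr_eq subrr eq_sym => /eqP xl.
  by split.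
- by exists p.
pose E := (D :&: kermx (normal R l)^T)%MS.
have rE : (\rank E).+1 = \rank D.
  rewrite -(mxrank_mul_ker D (normal R l)^T) -/E -add1n; congr (_ + _)%N.
  apply/eqP; rewrite eqn_leq rank_leq_col lt0n mxrank_eq0 andbT.
  apply/eqP => Dl0; have : (q - z) *m (normal R l)^T = 0.
    have /submxP[w ->] := mem_aff_diff qD zD.
    by rewrite -mulmxA Dl0 mulmx0.
  rewrite mulc => /rowP/(_ ord0); rewrite !mxE eqxx mulr1n dotp_normalB => /eqP.
  by rewrite subr_eq0 => /eqP e; move: zl; rewrite -e ltNge ltW.
rewrite fp_dimension -rE; congr _.+1.
apply: (@dimension_eq _ _ _ _ E p) => //.
- move=> x y [/(fp_mem FP)[xD _] xl] [/(fp_mem FP)[yD _] yl].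
  rewrite sub_capmx mem_aff_diff//; apply/sub_kermxP; rewrite mulc.
  by rewrite dotp_normalB xl yl subrr; apply/rowP => i; rewrite !mxE mul0rn.
- move=> m W; rewrite sub_capmx => /andP[WD /sub_kermxP Wl].
  have [l'|e e0 eP] := @fp_perturb [seq l' <- L | l' != l] 1 p m W.
    by rewrite mem_filter => /andP[nl l'L]; apply: pL.
  exists e => // i.
  have il : ev l (homog 1 (p + e *: row i W)) = 0.
    rewrite -[X in homog X]addr0 -[in X in 1 + X](mulr0 e) ev_homogD ev_homogZ pl add0r.
    rewrite ev_homog0; have : row i W *m (normal R l)^T = 0 by rewrite -row_mul Wl row0.
    by rewrite mulc => /rowP/(_ ord0); rewrite !mxE eqxx mulr1n => ->; rewrite mulr0.
  split=> //; apply/(fp_mem FP); split=> [|l' l'L].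
    rewrite addrAC addmx_sub// scalemx_sub//.
    exact: submx_trans (row_sub _ _) WD.
  have [->|nl] := eqVneq l' l; first by rewrite il.
  by apply/ltW/eP; rewrite mem_filter nl.
Qed.

End FacetPresentation.

(** * Dilates, relative interiors and translates *)

Section DilatesAndTranslates.
Variables (R : realType) (n k : nat).
Variables (P : set 'rV[R]_n) (p0 : 'rV[R]_n) (D : 'M[R]_(k, n)).
Variables (L : seq 'rV[rat]_n.+1) (q : 'rV[R]_n).
Hypothesis FP : facet_presentation P p0 D L q.

(** These are slices at height [s] of the homogenized affine hull and, below, of the cone over [P].
    They add along with their heights and make sense at height 0, which occurs for [t = 1] after the
    shift. *)
Definition hom_aff (s : R) (x : 'rV[R]_n) : Prop := (x - s *: p0 <= D)%MS.

Definition hom_closed (s : R) (x : 'rV[R]_n) : Prop :=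
  hom_aff s x /\ forall l, l \in L -> 0 <= ev l (homog s x).

Definition hom_open (s : R) (x : 'rV[R]_n) : Prop :=
  hom_aff s x /\ forall l, l \in L -> 0 < ev l (homog s x).

Lemma hom_affD s t x y : hom_aff s x -> hom_aff t y -> hom_aff (s + t) (x + y).
Proof.
by move=> sx ty; rewrite /hom_aff scalerDl opprD addrACA addmx_sub.
Qed.

Lemma hom_affZ c s x : hom_aff s x -> hom_aff (c * s) (c *: x).
Proof. by move=> sx; rewrite /hom_aff -scalerA -scalerBr scalemx_sub. Qed.

Lemma hom_affB s t x y : hom_aff s x -> hom_aff t y -> hom_aff (s - t) (x - y).
Proof.
by move=> sx ty; rewrite -[- t]mulN1r -[- y]scaleN1r; apply/hom_affD/hom_affZ.
Qed.

Lemma hom_closed1 x : P x <-> hom_closed 1 x.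
Proof. by rewrite /hom_closed /hom_aff scale1r; apply: fp_mem FP x. Qed.

Lemma hom_open1 : hom_open 1 q.
Proof.
split; first by rewrite /hom_aff scale1r; apply: fp_aff FP.
exact: fp_pos FP.
Qed.

Lemma mem_dilate (t : int) x : 0 < t -> dilate t P x <-> hom_closed t%:~R x.
Proof.
move=> t0; have tR : 0 < t%:~R :> R by rewrite ltr0z.
split=> [[y /hom_closed1[ya yL] <-]|[xa xL]].
  rewrite -[X in hom_closed X]mulr1; split; first exact: hom_affZ.
  by move=> l lL; rewrite ev_homogZ mulr_ge0 ?yL// ltW.
exists (t%:~R^-1 *: x); last by rewrite scalerA divff ?scale1r// gt_eqF.
apply/hom_closed1; rewrite -[X in hom_closed X](mulVf (lt0r_neq0 tR)); split; first exact: hom_affZ.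
by move=> l lL; rewrite ev_homogZ mulr_ge0 ?xL// invr_ge0 ltW.
Qed.

Lemma affine_hull_dilate (t : int) x : 0 < t ->
  affine_hull (dilate t P) x <-> hom_aff t%:~R x.
Proof.
move=> t0; have tR : 0 < t%:~R :> R by rewrite ltr0z.
split=> [[m [V [w [SV w1 ->]]]]|xa].
  rewrite /hom_aff; have -> : w *m V - t%:~R *: p0 =
      \sum_i w ord0 i *: (row i V - t%:~R *: p0).
    transitivity (w *m V - (\sum_i w ord0 i) *: (t%:~R *: p0)).
      by rewrite w1 scale1r.
    rewrite mulmx_sum_row scaler_suml -sumrB.
    by apply: eq_bigr => i _; rewrite scalerBr.
  by apply: summx_sub => i _; apply: scalemx_sub; have /(mem_dilate _ t0)[] := SV i.
have [qa qL] := hom_open1.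
pose qt := t%:~R *: q.
have qta : hom_aff t%:~R qt by rewrite -[X in hom_aff X]mulr1; apply: hom_affZ.
have qtL l : l \in L -> 0 < ev l (homog t%:~R qt).
  by move=> lL; rewrite -[X in homog X]mulr1 ev_homogZ mulr_gt0// qL.
have [e e0 eP] := fp_perturb (x - qt) qtL.
have ea : hom_aff t%:~R (qt + e *: (x - qt)).
  rewrite -[t%:~R]addr0 -[X in _ + X](mulr0 e) -[X in e * X](subrr t%:~R).
  by apply: hom_affD => //; apply: hom_affZ; apply: hom_affB.
(* [x] lies on the line through [qt] and a nearby point of the dilate; the weights [1 - e^-1] and
   [e^-1] undo the scaling by [e]. *)
exists (1 + 1)%N, (col_mx qt (qt + e *: (x - qt))), (row_mx (1 - e^-1)%:M (e^-1)%:M).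
split.
- move=> i; apply/(mem_dilate _ t0); case: (@split_ordP 1 1 i) => j ->.
    by rewrite rowKu ord1 row_id; split=> // l /qtL/ltW.
  rewrite rowKd ord1 row_id; split=> // l lL; apply: ltW.
  by have := eP ord0 l lL; rewrite row_id.
- rewrite big_split_ord /= !big_ord1.
  by rewrite row_mxEl row_mxEr !mxE !mulr1n subrK.
- rewrite (@mul_row_col _ 1 1 1) !mul_scalar_mx [e^-1 *: _]scalerDr [e^-1 *: (e *: _)]scalerA mulVf ?gt_eqF//.
  by rewrite scale1r addrA -scalerDl subrK scale1r addrC subrK.
Qed.

Lemma nbhs_coord (x : 'rV[R]_n) (e : R) : 0 < e ->
  nbhs x [set y | forall i, `|x ord0 i - y ord0 i| < e].
Proof.
move=> e0; apply/nbhs_ballP; exists e => // y xy i.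
by have [_] := xy; apply.
Qed.

Lemma relint_dilate (t : int) x : 0 < t ->
  relint (dilate t P) x <-> hom_open t%:~R x.
Proof.
move=> t0; have tR : 0 < t%:~R :> R by rewrite ltr0z.
split.
  case=> /(mem_dilate _ t0)[xa xL]; rewrite /within /= => /nbhs_ballP[e /= e0 xe].
  split=> // l lL; rewrite lt_neqAle xL// andbT eq_sym; apply/eqP => xl.
  have [qa qL] := hom_open1.
  (* If [l] vanished at [x], it would be negative just beyond [x] on the ray from [t q], yet points
     that close in the affine hull belong to the dilate. *)
  pose v := x - t%:~R *: q.
  pose s := [seq (e, v ord0 i) | i <- enum 'I_n] ++ [seq (e, - v ord0 i) | i <- enum 'I_n].
  have [p|d d0 dP] := @perturb R s.
    by rewrite mem_cat => /orP[] /mapP[i _ ->].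
  have : dilate t P (x + d *: v).
    apply: xe.
      split=> // i j; rewrite !ord1 /ball /=.
      have -> : x ord0 j - (x + d *: v) ord0 j = - (d * v ord0 j).
        by rewrite mxE [X in _ - (_ + X)]mxE opprD addrA subrr add0r.
      rewrite normrN ltr_norml; apply/andP; split; rewrite -subr_gt0.
        rewrite opprK addrC; apply: (dP d d0 (lexx _) (e, v ord0 j)).
        by rewrite mem_cat; apply/orP; left; apply/mapP; exists j; rewrite ?mem_enum.
      rewrite -mulrN; apply: (dP d d0 (lexx _) (e, - v ord0 j)).
      by rewrite mem_cat; apply/orP; right; apply/mapP; exists j; rewrite ?mem_enum.
    apply/affine_hull_dilate => //.
    rewrite -[t%:~R]addr0 -[X in _ + X](mulr0 d) -[X in d * X](subrr t%:~R).
    apply: hom_affD => //; apply: hom_affZ; apply: hom_affB => //.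
    by rewrite -[X in hom_aff X]mulr1; apply: hom_affZ.
  move=> /(mem_dilate _ t0)[_ /(_ l lL)].
  rewrite -[t%:~R]addr0 -[X in _ + X](mulr0 d) -[X in d * X](subrr t%:~R).
  rewrite ev_homogD ev_homogZ ev_homogB xl add0r sub0r.
  rewrite -[X in homog X (_ *: q)]mulr1 ev_homogZ mulrN oppr_ge0 leNgt.
  by rewrite !mulr_gt0// qL.
case=> xa xL; split.
  by apply/mem_dilate => //; split=> // l /xL/ltW.
(* The sum of absolute coefficients bounds the change of [l] per unit of the sup norm. *)
pose c (l : 'rV[rat]_n.+1) : R := \sum_i `|normal R l ord0 i|.
have [p|e e0 eP] := @perturb R [seq (ev l (homog t%:~R x), - c l) | l <- L].
  by move=> /mapP[l lL ->]; apply: xL.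
rewrite /within /=; apply: filterS (nbhs_coord x e0) => y xy /affine_hull_dilate ya.
apply/mem_dilate => //; split=> [|l lL]; first exact: ya.
apply/ltW; have := eP e e0 (lexx _) (ev l (homog t%:~R x), - c l) (map_f _ lL).
move=> /= /lt_le_trans; apply.
rewrite mulrN lerBlDr -lerBlDl -ev_homogB subrr ev_homog0 /dotp /c mulr_sumr.
apply: ler_sum => i _; rewrite !mxE mulrC.
apply: le_trans (ler_norm _) _; rewrite normrM ler_wpM2r//.
exact/ltW/xy.
Qed.

(** A form at height [t] splits as its value at a point of [Q] at height 1 plus its value at [a] at
    height [t - 1]. The first term is nonnegative on [Q] and vanishes at a vertex on the facet, so
    it affects neither the weak nor the strict inequality. *)
Lemma translate_sub_dilate Q (a : 'rV[int]_n) (t : int) :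
  0 < t -> Q !=set0 -> inscribed Q P ->
  (translate Q a `<=` dilate t P <-> hom_closed (t - 1)%:~R (map_mx intr a)) /\
  (translate Q a `<=` relint (dilate t P) <->
     hom_open (t - 1)%:~R (map_mx intr a)).
Proof.
move=> t0 [x0 Qx0] [QP Qfacet].
have tE : t%:~R = 1 + (t - 1)%:~R :> R by rewrite rmorphB /= addrC subrK.
have affE x : Q x -> hom_aff t%:~R (x + map_mx intr a) <->
    hom_aff (t - 1)%:~R (map_mx intr a).
  move=> /QP/hom_closed1[xa _]; rewrite tE; split=> [xaa|]; last exact: hom_affD.
  rewrite -[map_mx intr a](addrK x) -[(t - 1)%:~R](addrK 1) [_ + x]addrC [_ + 1]addrC.
  exact: hom_affB.
have touch l : l \in L -> exists2 v, Q v & ev l (homog 1 v) = 0.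
  move=> /(fp_facet FP)/Qfacet[v [c [b [_ vE]]] [_ vl]].
  by exists v => //; have : [set v] v by []; rewrite vE => -[].
split; split.
- move=> sub; split.
    by apply/(affE x0 Qx0); have /(mem_dilate _ t0)[] : dilate t P (x0 + map_mx intr a)
      by apply: sub; exists x0.
  move=> l /[dup] lL /touch[v Qv vl].
  have /(mem_dilate _ t0)[_ /(_ l lL)] : dilate t P (v + map_mx intr a).
    by apply: sub; exists v.
  by rewrite tE ev_homogD vl add0r.
- move=> [aa aL] _ [x Qx <-]; apply/(mem_dilate _ t0); split; first exact/affE.
  move=> l lL; rewrite tE ev_homogD addr_ge0 ?aL//.
  by have /hom_closed1[_] := QP _ Qx; apply.
- move=> sub; split.
    by apply/(affE x0 Qx0); have /(relint_dilate _ t0)[] :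
        relint (dilate t P) (x0 + map_mx intr a) by apply: sub; exists x0.
  move=> l /[dup] lL /touch[v Qv vl].
  have /(relint_dilate _ t0)[_ /(_ l lL)] : relint (dilate t P) (v + map_mx intr a).
    by apply: sub; exists v.
  by rewrite tE ev_homogD vl add0r.
- move=> [aa aL] _ [x Qx <-]; apply/(relint_dilate _ t0); split; first exact/affE.
  move=> l lL; rewrite tE ev_homogD ltr_wpDl ?aL//.
  by have /hom_closed1[_] := QP _ Qx; apply.
Qed.

End DilatesAndTranslates.

(** * Facet presentation of a rational polytope *)

Section RationalPolytopes.
Variables (R : realType) (n : nat).
Implicit Types (P : set 'rV[R]_n) (L : seq 'rV[rat]_n.+1).

(** Forms implied on [A] by the others are deleted one at a time. Redundancy is relative to [A],
    which will be the affine hull. *)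
Lemma irredundant (A : set 'rV[R]_n) L : exists L', [/\ {subset L' <= L},
  forall x, A x -> (forall l, l \in L' -> 0 <= ev l (homog 1 x)) ->
    forall l, l \in L -> 0 <= ev l (homog 1 x) &
  forall l, l \in L' -> exists z, [/\ A z,
    forall l', l' \in L' -> l' != l -> 0 <= ev l' (homog 1 z) & ev l (homog 1 z) < 0]].
Proof.
have [m] := ubnP (size L); elim: m L => // m IH L sL.
have [[l lL red]|irr] := pselect (exists2 l, l \in L & forall z, A z ->
    (forall l', l' \in L -> l' != l -> 0 <= ev l' (homog 1 z)) -> 0 <= ev l (homog 1 z)).
  have [|L' [sub imp min]] := IH [seq l' <- L | l' != l].
    rewrite -ltnS; apply: leq_trans sL; rewrite ltnS size_filter -(count_predC (pred1 l) L).
    by rewrite -addn1 addnC leq_add2r -has_count has_pred1.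
  exists L'; split=> // [l' /sub|x Ax xL']; first by rewrite mem_filter => /andP[].
  have xL := imp x Ax xL'.
  have lx : 0 <= ev l (homog 1 x).
    by apply: red => // l' l'L nl; apply: xL; rewrite mem_filter nl.
  move=> l' l'L; have [-> //|nl] := eqVneq l' l.
  by apply: xL; rewrite mem_filter nl.
exists L; split=> // l lL; apply: contrapT => h; apply: irr; exists l => // z Az zL.
by rewrite leNgt; apply/negP => zl; apply: h; exists z.
Qed.

Lemma ratv_homog (r : 'rV[rat]_n) : ratv R (homog 1 r) = homog 1 (map_mx ratr r).
Proof.
apply/rowP => i; rewrite !mxE; case: unliftP => [j|] _ /=; first by rewrite mxE.
by rewrite rmorph1.
Qed.

(** The polytope is the slice at height 1 of the cone over its points; the height coordinate makes
    the weights sum to 1. *)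
Lemma conv_rows_halfspaces k (V : 'M[rat]_(k, n)) : exists L, forall x : 'rV[R]_n,
  conv_rows (map_mx ratr V) x <-> forall l, l \in L -> 0 <= ev l (homog 1 x).
Proof.
have [L LP] := cone_halfspaces R [seq homog 1 (row i V) | i <- enum 'I_k].
exists L => x; rewrite -LP (in_cone_map _ _ (enum_uniq 'I_k)); split.
  case=> w [w0 w1] <-; exists (w ord0) => //.
  rewrite big_enum /=; apply/rowP => i; rewrite summxE.
  case: (unliftP ord0 i) => [j|] ->.
    rewrite homog_lift mxE; apply: eq_bigr => a _.
    by rewrite [RHS]mxE ratv_homog homog_lift !mxE.
  by rewrite homog0 -w1; apply: eq_bigr => a _; rewrite mxE ratv_homog homog0 mulr1.
case=> c c0; rewrite big_enum /= => xE; exists (\row_i c i).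
  split=> [i|]; first by rewrite mxE.
  move/rowP/(_ ord0): xE; rewrite homog0 summxE => ->.
  by apply: eq_bigr => a _; rewrite [in RHS]mxE ratv_homog homog0 mulr1 mxE.
apply/rowP => j; move/rowP/(_ (lift ord0 j)): xE; rewrite homog_lift summxE => ->.
by rewrite mxE; apply: eq_bigr => a _; rewrite [in RHS]mxE ratv_homog homog_lift !mxE.
Qed.

Lemma rational_facet_presentation P : rational_polytope P -> P !=set0 ->
  exists k (D : 'M[rat]_(k, n)) (r0 : 'rV[rat]_n) L q,
    facet_presentation P (map_mx ratr r0) (map_mx ratr D) L q /\
    exists M : nat, forall x, P x -> forall j, `|x ord0 j| < M%:R.
Proof.
case=> k [V PE] P0; have [L0 L0P] := conv_rows_halfspaces V.
have k0 : (0 < k)%N.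
  case: k V PE {L0P} => // V PE; case: P0 => x; rewrite PE => -[w [_ +] _].
  by rewrite big_ord0 => /eqP; rewrite eq_sym oner_eq0.
pose i0 := Ordinal k0.
pose D := \matrix_i (row i V - row i0 V).
pose VR : 'M[R]_(k, n) := map_mx ratr V.
have DE i : row i (map_mx ratr D) = row i VR - row i0 VR.
  by apply/rowP => j; rewrite !mxE rmorphB.
have p0E : map_mx ratr (row i0 V) = row i0 VR by rewrite map_row.
have PV i : P (row i VR).
  rewrite PE; exists (delta_mx ord0 i); last by rewrite rowE.
  split=> [j|]; first by rewrite mxE; case: (_ && _).
  by rewrite (bigD1 i)//= big1 ?addr0 ?mxE ?eqxx// => j ji; rewrite mxE (negPf ji) andbF.
have affP x : P x -> (x - row i0 VR <= map_mx ratr D)%MS.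
  rewrite PE => -[w [_ w1] <-]; have -> : w *m VR - row i0 VR =
      \sum_i w ord0 i *: row i (map_mx ratr D).
    transitivity (w *m VR - (\sum_i w ord0 i) *: row i0 VR).
      by rewrite w1 scale1r.
    rewrite mulmx_sum_row scaler_suml -sumrB.
    by apply: eq_bigr => i _; rewrite DE scalerBr.
  by apply: summx_sub => i _; apply: scalemx_sub; apply: row_sub.
(* Forms vanishing at all generating points vanish on the whole affine hull and cannot be positive
   anywhere in [P]. The others are positive at the barycentre [q]. *)
pose L1 := [seq l <- L0 | has (fun i => evq l (homog 1 (row i V)) != 0) (enum 'I_k)].
have evV l i : ev l (homog 1 (row i VR)) = ratr (evq l (homog 1 (row i V))).
  by rewrite -ev_ratv ratv_homog map_row.
pose c : R := k%:R^-1.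
have c0 : 0 < c by rewrite invr_gt0 ltr0n.
pose q := \sum_i c *: row i VR.
have Pq : P q.
  rewrite PE; exists (const_mx c); last first.
    by rewrite mulmx_sum_row; apply: eq_bigr => i _; rewrite mxE.
  split=> [i|]; first by rewrite mxE ltW.
  under eq_bigr do rewrite mxE.
  by rewrite sumr_const card_ord -mulr_natr mulVf// pnatr_eq0 -lt0n.
have ev_q l : ev l (homog 1 q) = \sum_i c * ev l (homog 1 (row i VR)).
  have -> : homog 1 q = \sum_i c *: homog 1 (row i VR).
    apply/rowP => i; rewrite summxE; case: (unliftP ord0 i) => [j|] ->.
      by rewrite homog_lift summxE; apply: eq_bigr => a _; rewrite mxE [RHS]mxE homog_lift.
    rewrite homog0; under eq_bigr do rewrite mxE homog0 mulr1.
    by rewrite sumr_const card_ord -mulr_natr mulVf// pnatr_eq0 -lt0n.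
  rewrite (big_morph (ev l) (evDr l) (id1 := 0)); first by apply: eq_bigr => i _; rewrite evZr.
  by rewrite -(scale0r 0) evZr mul0r.
have L1q l : l \in L1 -> 0 < ev l (homog 1 q).
  rewrite mem_filter => /andP[/hasP[i _ li] lL0]; rewrite ev_q.
  have ge j : 0 <= c * ev l (homog 1 (row j VR)).
    by rewrite mulr_ge0 ?(ltW c0)//; move: (PV j); rewrite PE => /L0P; apply.
  rewrite lt_neqAle sumr_ge0// andbT eq_sym psumr_neq0//.
  apply/hasP; exists i; rewrite ?mem_index_enum//= lt_neqAle ge andbT eq_sym.
  by apply: mulf_neq0; [rewrite gt_eqF|rewrite evV fmorph_eq0].
have L1P x : (x - row i0 VR <= map_mx ratr D)%MS ->
    (forall l, l \in L1 -> 0 <= ev l (homog 1 x)) -> P x.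
  move=> /submxP[w xE] xL1; rewrite PE; apply/L0P => l lL0.
  have [hl|nl] := boolP (has (fun i => evq l (homog 1 (row i V)) != 0) (enum 'I_k)).
    by apply: xL1; rewrite mem_filter hl.
  have lV i : ev l (homog 1 (row i VR)) = 0.
    move/hasPn/(_ i): nl; rewrite mem_enum => /(_ isT)/negPn/eqP lV.
    by rewrite evV lV rmorph0.
  rewrite -[x](subrK (row i0 VR)) xE -[X in homog X]add0r ev_homogD lV addr0 ev_homog0.
  rewrite mulmx_sum_row /dotp.
  have -> : \sum_i normal R l ord0 i * (\sum_j w ord0 j *: row j (map_mx ratr D)) ord0 i
     = \sum_j w ord0 j * dotp (normal R l) (row j VR - row i0 VR).
    under eq_bigr => i _ do rewrite summxE mulr_sumr.
    rewrite exchange_big; apply: eq_bigr => j _; rewrite /dotp mulr_sumr.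
    by apply: eq_bigr => i _; rewrite -DE [X in _ * X = _]mxE mulrCA.
  by rewrite big1// => j _; rewrite dotp_normalB !lV subrr mulr0.
have [L [LL1 LL min]] := irredundant [set x | (x - row i0 VR <= map_mx ratr D)%MS] L1.
exists k, D, (row i0 V), L, q; rewrite p0E; split.
  split=> //; last 2 first.
  - exact: affP.
  - by move=> l /LL1/L1q.
  move=> x; split=> [Px|[xD xL]]; last by apply: L1P => // l; apply: LL.
  split=> [|l /LL1]; first exact: affP.
  by rewrite mem_filter => /andP[_]; move: Px; rewrite PE => /L0P; apply.
(* The bound is strict, so that the box forms built from [M] are positive on [P] and hold in the
   open region as well. *)
pose b : R := \sum_j \sum_i `|VR i j|.
have b0 : 0 <= b by do 2!apply: sumr_ge0 => ? _.
exists (Num.bound b) => x; rewrite PE => -[w [w0 w1] <-] j.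
apply: le_lt_trans (archi_boundP b0); rewrite mxE.
apply: le_trans (ler_norm_sum _ _ _) _.
rewrite /b (bigD1 j)//= ler_wpDr//; first by do 2!apply: sumr_ge0 => ? _.
apply: ler_sum => i _; rewrite normrM ger0_norm// ler_piMl// -w1 (bigD1 i)//=.
by rewrite ler_wpDr// sumr_ge0.
Qed.

End RationalPolytopes.

(** * Lattice points of dilates *)

Section QuasiPolynomialsOfOneVariable.
Variable R : realType.
Implicit Types f g : int -> R.

Lemma periodic_mul (T : Type) (p : int -> T) (N : nat) :
  (forall t, p (t + N%:Z) = p t) ->
  forall (k : nat) t, p (t + (N * k)%N%:Z) = p t.
Proof.
move=> pN; elim=> [|k IH] t; first by rewrite muln0 addr0.
by rewrite mulnSr PoszD addrA pN IH.
Qed.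

Lemma quasi_polynomial_op (op : {poly R} -> {poly R} -> {poly R}) (rop : R -> R -> R) f g :
  (forall p q x, (op p q).[x] = rop p.[x] q.[x]) ->
  quasi_polynomial f -> quasi_polynomial g ->
  quasi_polynomial (fun t => rop (f t) (g t)).
Proof.
move=> opE [N [p [N0 pN fp]]] [M [q [M0 qM gq]]].
exists (N * M)%N, (fun t => op (p t) (q t)); split.
- by rewrite muln_gt0 N0.
- by move=> t; rewrite (periodic_mul pN) mulnC (periodic_mul qM).
- by move=> t; rewrite opE -fp -gq.
Qed.

Lemma qpoly_axis n (f : 'rV[int]_n.+1 -> R) :
  qpoly f -> quasi_polynomial (fun t => f (axis n t)).
Proof.
elim=> {f} [f M M0 pf|i|f g _ qf _ qg|f g _ qf _ qg].
- exists M, (fun t => (f (axis n t))%:P); split=> // t; last by rewrite hornerC.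
  congr (_%:P); rewrite -[RHS](pf _ (axis n 1)); congr f.
  by rewrite /axis -scaler_nat natz scalerA mulr1 scalerDl.
- have [->|i0] := eqVneq i ord0.
    exists 1%N, (fun=> 'X); split=> // t.
    by rewrite hornerX !mxE !eqxx mulr1.
  exists 1%N, (fun=> 0); split=> // t.
  by rewrite horner0 !mxE (negPf i0) andbF mulr0.
- by apply: (@quasi_polynomial_op +%R +%R) qf qg => p q x; rewrite hornerD.
- by apply: (@quasi_polynomial_op *%R *%R) qf qg => p q x; rewrite hornerM.
Qed.

Lemma quasi_polynomial_shift f (c : int) :
  quasi_polynomial f -> quasi_polynomial (fun t => f (t + c)).
Proof.
case=> N [p [N0 pN fp]]; exists N, (fun t => p (t + c) \Po ('X + c%:~R%:P)).
split=> // t; first by rewrite addrAC pN.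
by rewrite fp horner_comp hornerD hornerX hornerC rmorphD.
Qed.

End QuasiPolynomialsOfOneVariable.

(** * Counting lattice points through independent coordinates *)

Section LatticePointCount.
Variables (R : realType) (n k : nat).
Variables (P : set 'rV[R]_n) (r0 : 'rV[rat]_n) (D : 'M[rat]_(k, n)).
Variables (L : seq 'rV[rat]_n.+1) (q : 'rV[R]_n) (M : nat).
Let p0 : 'rV[R]_n := map_mx ratr r0.
Let DR : 'M[R]_(k, n) := map_mx ratr D.
Hypothesis FP : facet_presentation P p0 DR L q.
Hypothesis PM : forall x, P x -> forall j, `|x ord0 j| < M%:R.

Let r := \rank D^T.
(* The coordinates indexed by [f] parametrize the affine hull of [P]; the
   other ones are the values of the forms [solve] below. *)
Let f : 'I_r -> 'I_n := maxrankfun D^T.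
Let DJ : 'M[rat]_(r, k) := rowsub f D^T.

Lemma coord_coef_exists : exists C : 'M[rat]_(n, r), D^T = C *m DJ.
Proof. by apply/submxP; rewrite eq_maxrowsub. Qed.

Let C := projT1 (cid coord_coef_exists).

Lemma coord_coefE : D^T = C *m DJ.
Proof. exact: (projT2 (cid coord_coef_exists)). Qed.

Lemma coord_coef1 a b : C (f a) b = (a == b)%:R.
Proof.
have : rowsub f C *m DJ = 1%:M *m DJ by rewrite mul1mx mul_rowsub_mx -coord_coefE.
by move/(row_free_inj (maxrowsub_free _))/matrixP/(_ a b); rewrite !mxE.
Qed.

Lemma ev_suml (I : Type) (s : seq I) (F : I -> 'rV[rat]_n.+1) (y : 'rV[R]_n.+1) :
  ev (\sum_(i <- s) F i) y = \sum_(i <- s) ev (F i) y.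
Proof.
exact: (big_morph (fun l => ev l y) (fun a b => evDl a b y) (ev0l y)).
Qed.

(** On the affine hull at height [t], the deviation of [x] from [t r0] is [C] applied to its free
    coordinates; this is that relation solved for the [j]-th coordinate. *)
Definition solve (j : 'I_n) : 'rV[rat]_n.+1 :=
  (r0 ord0 j - \sum_a C j a * r0 ord0 (f a)) *: delta_mx ord0 ord0 +
  \sum_a C j a *: delta_mx ord0 (lift ord0 (f a)).

Lemma ev_solve j (y : 'rV[R]_n.+1) : ev (solve j) y =
  y ord0 ord0 * ratr (r0 ord0 j) + \sum_a ratr (C j a) *
    (y ord0 (lift ord0 (f a)) - y ord0 ord0 * ratr (r0 ord0 (f a))).
Proof.
rewrite /solve evDl evZl ev_coord ev_suml rmorphB rmorph_sum mulrBl.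
rewrite mulrC -addrA; congr (_ + _); rewrite mulr_suml addrC -sumrB.
apply: eq_bigr => a _; rewrite evZl ev_coord rmorphM mulrBr; congr (_ - _).
by rewrite -mulrA; congr (_ * _); apply: mulrC.
Qed.

Lemma ev_solve_free a (y : 'rV[R]_n.+1) : ev (solve (f a)) y = y ord0 (lift ord0 (f a)).
Proof.
rewrite ev_solve (bigD1 a)//= big1 => [|b ba].
  by rewrite coord_coef1 eqxx rmorph1 mul1r addr0 addrC subrK.
by rewrite coord_coef1 eq_sym (negPf ba) rmorph0 mul0r.
Qed.

Lemma hom_affP s (x : 'rV[R]_n) :
  hom_aff p0 DR s x <-> forall j, ev (solve j) (homog s x) = x ord0 j.
Proof.
pose CR : 'M[R]_(n, r) := map_mx ratr C; pose DJR : 'M[R]_(r, k) := map_mx ratr DJ.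
have DRE : DR^T = CR *m DJR by rewrite -map_mxM -coord_coefE map_trmx.
have DJE : rowsub f DR^T = DJR by apply/matrixP => a i; rewrite !mxE.
have DJfree : row_free DJR by rewrite /row_free mxrank_map; apply: maxrowsub_free.
pose d := x - s *: p0.
have solveE : (forall j, ev (solve j) (homog s x) = x ord0 j) <->
    d^T = CR *m rowsub f d^T.
  have evE j : (ev (solve j) (homog s x) = x ord0 j) <->
      (d^T j ord0 = (CR *m rowsub f d^T) j ord0).
    rewrite ev_solve homog0 mxE.
    have -> : (CR *m rowsub f d^T) j ord0 = \sum_a ratr (C j a) *
        (homog s x ord0 (lift ord0 (f a)) - s * ratr (r0 ord0 (f a))).
      by rewrite mxE; apply: eq_bigr => a _; rewrite homog_lift !mxE.
    rewrite /d !mxE; split=> [<-|<-]; first by rewrite addrC addKr.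
    by rewrite addrCA subrr addr0.
  split=> [h|h j]; last by apply/evE; rewrite -h.
  by apply/colP => j; apply/evE.
rewrite solveE /hom_aff -/d; split=> [/submxP[c ->]|dE].
  by rewrite trmx_mul -mul_rowsub_mx DJE mulmxA -DRE.
apply/submxP; exists (pinvmx DJR *m rowsub f d^T)^T.
apply: trmx_inj; rewrite trmx_mul trmxK DRE -mulmxA [DJR *m _]mulmxA.
by rewrite mulmxVp// mul1mx.
Qed.

Definition subst_form (l : 'rV[rat]_n.+1) : 'rV[rat]_n.+1 :=
  l ord0 ord0 *: delta_mx ord0 ord0 + \sum_j l ord0 (lift ord0 j) *: solve j.

Lemma ev_subst_form l s (x : 'rV[R]_n) : hom_aff p0 DR s x ->
  ev (subst_form l) (homog s x) = ev l (homog s x).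
Proof.
move/hom_affP => xE; rewrite evDl evZl ev_coord ev_suml [RHS]big_ord_recl.
by congr (_ + _); apply: eq_bigr => j _; rewrite evZl xE homog_lift.
Qed.

Definition free_coords : seq 'I_n.+1 := [seq lift ord0 (f a) | a <- enum 'I_r].

Lemma mem_free_coords a : lift ord0 (f a) \in free_coords.
Proof. by apply/mapP; exists a; rewrite ?mem_enum. Qed.

Lemma free_coords_uniq : uniq free_coords.
Proof.
by rewrite map_inj_uniq ?enum_uniq// => a b /lift_inj; apply: maxrankfun_inj.
Qed.

Lemma free_coords0 : ord0 \notin free_coords.
Proof. by apply/mapP => -[a _] /eqP; rewrite (negPf (neq_lift _ _)). Qed.

Lemma solve_supp j i : i \notin ord0 :: free_coords -> solve j ord0 i = 0.
Proof.
rewrite inE negb_or => /andP[i0 iN]; rewrite mxE summxE !mxE (negPf i0) andbF mulr0 add0r.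
rewrite big1// => a _; rewrite !mxE /=; case: eqP iN => [->|_]; last by rewrite mulr0.
by rewrite mem_free_coords.
Qed.

Lemma ev_supp (l : 'rV[rat]_n.+1) (y z : 'rV[R]_n.+1) :
  (forall i, i \notin ord0 :: free_coords -> l ord0 i = 0) ->
  (forall i, i \in ord0 :: free_coords -> y ord0 i = z ord0 i) ->
  ev l y = ev l z.
Proof.
move=> l0 yz; apply: eq_bigr => i _.
have [/yz->//|/l0 ->] := boolP (i \in ord0 :: free_coords).
by rewrite rmorph0 !mul0r.
Qed.

Lemma subst_form_supp l i : i \notin ord0 :: free_coords -> subst_form l ord0 i = 0.
Proof.
move=> iN; rewrite /subst_form mxE summxE big1 => [|j _].
  by move: iN; rewrite inE negb_or !mxE eqxx /= => /andP[/negPf-> _]; rewrite mulr0 addr0.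
by rewrite mxE solve_supp ?mulr0.
Qed.

(** The box forms exclude no point of the dilates of [P]; they supply the bounds that the
    elimination asks for. *)
Definition region_forms : seq 'rV[rat]_n.+1 := map subst_form L ++
  [seq M%:R *: delta_mx ord0 ord0 - delta_mx ord0 j | j <- free_coords] ++
  [seq M%:R *: delta_mx ord0 ord0 + delta_mx ord0 j | j <- free_coords].

Lemma region_forms_supp l i : l \in region_forms ->
  i \notin ord0 :: free_coords -> l ord0 i = 0.
Proof.
rewrite !mem_cat => /or3P[] /mapP[j jL ->] iN; first exact: subst_form_supp.
all: move: (iN); rewrite inE negb_or => /andP[i0 ifree].
all: have ij : i != j by apply: contraNneq ifree => ->.
all: by rewrite !mxE (negPf i0) (negPf ij) andbF mulr0 ?subrr ?addr0.
Qed.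

Definition cmp0 (strict : bool) (x : R) := if strict then 0 < x else 0 <= x.

Definition hom_region strict (t : int) : set 'rV[int]_n :=
  [set a | hom_aff p0 DR t%:~R (map_mx intr a) /\
     forall l, l \in L -> cmp0 strict (ev l (homog t%:~R (map_mx intr a)))].

(** The free coordinates determine a lattice point of the affine hull, but integral values of them
    may give fractional solved coordinates. This test is the periodic summand that selects the
    genuine lattice points. *)
Definition integral (z : 'rV[int]_n.+1) : bool :=
  [forall j, ev (solve j) (intv R z) \is a Num.int].

Lemma card_hom_region strict (t : int) (B : nat) : 0 < t -> M%:Z * t <= B%:Z ->
  #|` fset_set (hom_region strict t)|%fset%:R =
  \sum_(z <- box_points B free_coords (axis n t))
    (all (fun l => cmp0 strict (ev l (intv R z))) region_forms)%:R *
    (integral z)%:R :> R.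
Proof.
move=> t0 MtB; have tR : 0 < t%:~R :> R by rewrite ltr0z.
pose cond z := all (fun l => cmp0 strict (ev l (intv R z))) region_forms && integral z.
pose pts := box_points B free_coords (axis n t).
(* The floor only converts to integers: on the points with [cond] the values are integral
   already. *)
pose g z : 'rV[int]_n := \row_j Num.floor (ev (solve j) (intv R z)).
have fu : uniq free_coords by exact: free_coords_uniq.
have ptsP z : z \in pts -> [/\ z ord0 ord0 = t,
    forall b, `|z ord0 (lift ord0 (f b))| <= B%:Z &
    forall i, i \notin ord0 :: free_coords -> z ord0 i = 0].
  rewrite mem_box_points// => /forallP zP; split=> [|b|i].
  - have := zP ord0; rewrite (negPf free_coords0) => /eqP ->.
    by rewrite !mxE !eqxx mulr1.
  - by have := zP (lift ord0 (f b)); rewrite mem_free_coords.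
  - rewrite inE negb_or => /andP[i0 ifree]; have := zP i.
    by rewrite (negPf ifree) !mxE (negPf i0) andbF mulr0 => /eqP.
have agree z (a : 'rV[int]_n) (l : 'rV[rat]_n.+1) : z \in pts ->
    (forall b, a ord0 (f b) = z ord0 (lift ord0 (f b))) ->
    (forall i, i \notin ord0 :: free_coords -> l ord0 i = 0) ->
    ev l (intv R z) = ev l (homog t%:~R (map_mx intr a)).
  move=> /ptsP[z0 _ _] az l0; apply: ev_supp => // i.
  rewrite inE => /orP[/eqP->|/mapP[b _ ->]]; first by rewrite homog0 mxE z0.
  by rewrite homog_lift !mxE az.
have gE z j : cond z -> (g z ord0 j)%:~R = ev (solve j) (intv R z).
  by case/andP=> _ /forallP zi; rewrite mxE floorK// zi.
have gfree z b : cond z -> g z ord0 (f b) = z ord0 (lift ord0 (f b)).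
  by move=> cz; apply: (@intr_inj R); rewrite gE// ev_solve_free mxE.
have affg z a : z \in pts -> cond z -> a = g z ->
    hom_aff p0 DR t%:~R (map_mx intr a).
  move=> zpts cz ->; apply/hom_affP => j.
  rewrite -(agree z) => [|//|b|i]; [|exact: gfree|exact: solve_supp].
  by rewrite mxE gE.
have cardE : hom_region strict t =
    [set` [fset a in map g [seq z <- pts | cond z]]%fset].
  apply/seteqP; split=> a /=.
    case=> aa aL; rewrite in_fset /=; apply/mapP.
    have Pa : P (t%:~R^-1 *: map_mx intr a).
      apply/(hom_closed1 FP); split.
        by rewrite -[X in hom_aff _ _ X](mulVf (lt0r_neq0 tR)); apply: hom_affZ.
      move=> l lL; rewrite -[X in homog X](mulVf (lt0r_neq0 tR)) ev_homogZ.
      rewrite mulr_ge0 ?invr_ge0 ?(ltW tR)//.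
      by have := aL l lL; rewrite /cmp0; case: (strict) => // /ltW.
    have aM j : `|(a ord0 j)%:~R : R| < M%:R * t%:~R.
      have := PM Pa j; rewrite !mxE normrM normfV (ger0_norm (ltW tR)).
      by rewrite mulrC ltr_pdivrMr.
    (* The inverse of [g]: keep the height and the free coordinates, and put 0 elsewhere as
       [box_points] does. *)
    pose z : 'rV[int]_n.+1 := \row_i
      (if i \in ord0 :: free_coords then homog t a ord0 i else 0).
    have zpts : z \in pts.
      rewrite mem_box_points//; apply/forallP => i; rewrite mxE inE.
      have [/mapP[b _ ->]|ifree] := boolP (i \in free_coords).
        rewrite orbT homog_lift -(ler_int R) intr_norm.
        apply: le_trans (ltW (aM _)) _.
        by rewrite -[M%:R]/(M%:Z%:~R) -rmorphM ler_int.
      rewrite orbF; case: (eqVneq i ord0) => [->|i0]; first by rewrite homog0 !mxE !eqxx mulr1.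
      by rewrite !mxE (negPf i0) andbF mulr0.
    have az b : a ord0 (f b) = z ord0 (lift ord0 (f b)).
      by rewrite mxE inE mem_free_coords orbT homog_lift.
    have evz j : ev (solve j) (intv R z) = (a ord0 j)%:~R.
      rewrite (agree z a)//; last exact: solve_supp.
      by have /hom_affP -> := aa; rewrite mxE.
    exists z; last by apply/rowP => j; rewrite mxE evz intrKfloor.
    rewrite mem_filter zpts andbT; apply/andP; split; last first.
      by apply/forallP => j; rewrite evz intr_int.
    apply/allP => l lreg; rewrite (agree z a)//; last by move=> i; apply: region_forms_supp.
    move: lreg; rewrite !mem_cat => /or3P[] /mapP[j jL ->].
    + by rewrite ev_subst_form//; apply: aL.
    + move: jL => /mapP[b _ ->]; rewrite evBl evZl !ev_coord homog0 homog_lift ratr_nat mxE.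
      have : 0 < M%:R * t%:~R - (a ord0 (f b))%:~R :> R.
        by rewrite subr_gt0 (le_lt_trans (ler_norm _))// aM.
      by rewrite /cmp0; case: (strict) => // /ltW.
    + move: jL => /mapP[b _ ->]; rewrite evDl evZl !ev_coord homog0 homog_lift ratr_nat mxE.
      have : 0 < M%:R * t%:~R + (a ord0 (f b))%:~R :> R.
        rewrite -[X in _ + X]opprK subr_gt0 (le_lt_trans (ler_norm _))//.
        by rewrite normrN aM.
      by rewrite /cmp0; case: (strict) => // /ltW.
  rewrite in_fset /= => /mapP[z]; rewrite mem_filter => /andP[cz zpts] aE.
  have aa := affg z a zpts cz aE; split=> // l lL.
  rewrite -ev_subst_form// -(agree z) => [|//|b|i].
  - case/andP: cz => /allP/(_ (subst_form l)) h _; apply: h.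
    by rewrite mem_cat map_f.
  - by rewrite aE gfree.
  - exact: subst_form_supp.
rewrite cardE set_fsetK card_fseq undup_id ?size_map; last first.
  rewrite map_inj_in_uniq ?filter_uniq ?box_points_uniq// => z z'.
  rewrite !mem_filter => /andP[cz zpts] /andP[cz' z'pts] gz.
  have [z0 _ zN] := ptsP _ zpts; have [z0' _ zN'] := ptsP _ z'pts.
  apply/rowP => i; have [|iN] := boolP (i \in ord0 :: free_coords).
    rewrite inE => /orP[/eqP->|/mapP[b _ ->]]; first by rewrite z0 z0'.
    by rewrite -!gfree// gz.
  by rewrite zN// zN'.
rewrite size_filter -sum1_count natr_sum big_mkcond; apply: eq_bigr => z _.
by rewrite /cond; case: all; case: integral; rewrite ?mulr1 ?mulr0.
Qed.

Lemma qpoly_integral : qpoly (fun z => (integral z)%:R : R).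
Proof.
have [N NP] := choice (fun j => (let: ex_intro2 N N0 NP := ev_intv_den R (solve j) in
  ex_intro (fun N => (0 < N)%N /\ forall z, ev (solve j) (intv R (z *+ N)) \is a Num.int)
    N (conj N0 NP))).
apply: (@qpoly_periodic _ _ _ (\prod_j N j)%N).
  by rewrite prodn_gt0// => j; case: (NP j).
move=> y z; congr (_%:R); congr nat_of_bool; apply: eq_forallb => j.
rewrite intvD evDr (bigD1 j)//= mulnC mulrnA rpredDr//.
by case: (NP j).
Qed.

Lemma integralN z : integral (- z) = integral z.
Proof. by apply: eq_forallb => j; rewrite intvN evNr rpredN. Qed.

Theorem hom_region_reciprocity : exists2 g, quasi_polynomial g &
  forall t : int, 0 < t ->
    (#|` fset_set (hom_region false t)|%fset)%:R = g t :> R /\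
    (#|` fset_set (hom_region true t)|%fset)%:R = (-1) ^+ \rank D * g (- t) :> R.
Proof.
(* Comparing forms first by their value at the interior point [q] makes all the
   region forms positive. *)
have [pos0 op0] := form_order_exists R n.+1.
pose pos := lex (homog 1 q) pos0.
have op : form_order pos by apply: lex_form_order.
have qa : hom_aff p0 DR 1 q by rewrite /hom_aff scale1r; apply: fp_aff FP.
have Pq : P q.
  apply/(fp_mem FP); split=> [|l lL]; last exact/ltW/(fp_pos FP).
  exact: (fp_aff FP).
have posq l : l \in region_forms -> pos l.
  move=> lreg; rewrite /pos /lex; apply/orP; left; move: lreg.
  rewrite !mem_cat => /or3P[] /mapP[j jL ->].
  - by rewrite ev_subst_form// (fp_pos FP).
  - move: jL => /mapP[a _ ->]; rewrite evBl evZl !ev_coord homog0 homog_lift mulr1.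
    rewrite ratr_nat subr_gt0; exact: le_lt_trans (ler_norm _) (PM Pq _).
  - move: jL => /mapP[a _ ->]; rewrite evDl evZl !ev_coord homog0 homog_lift mulr1.
    rewrite ratr_nat -[X in 0 < _ + X]opprK subr_gt0.
    by apply: le_lt_trans (PM Pq (f a)); rewrite -normrN ler_norm.
have satE strict z :
    all (sat R (if strict then opp_order pos else pos) z) region_forms =
    all (fun l => cmp0 strict (ev l (intv R z))) region_forms.
  apply: eq_in_all => l /posq pl; rewrite /sat /lex /cmp0.
  case: strict; last by rewrite pl andbT le_eqVlt eq_sym orbC.
  by rewrite /opp_order (negPf (form_order_asym op pl)) andbF orbF.
have [||g qg gE] := lattice_sum op free_coords_uniq free_coords0 (L := region_forms) (M := M) qpoly_integral.
- by move=> l lreg i; apply: region_forms_supp.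
- move=> j jf; rewrite !mem_cat.
  by split; apply/orP; right; apply/orP; [left|right]; apply/mapP; exists j.
exists (fun t => g (axis n t)); first exact: qpoly_axis.
move=> t t0; have MtB : M%:Z * t <= (absz (M%:Z * t))%:Z by exact: lez_abs.
have [gpos gneg] := gE t _ t0 MtB.
rewrite !(card_hom_region _ t0 MtB); split.
  rewrite -gpos; apply: eq_bigr => z _; by rewrite -(satE false).
have -> : axis n (- t) = - axis n t by rewrite /axis scaleNr.
(* There is one sign per free coordinate, and these number [\rank D]. The integrality test is even,
   so negating the points leaves the summand unchanged. *)
rewrite -mxrank_tr -[\rank D^T](size_enum_ord r) -(size_map (fun a => lift ord0 (f a))).
rewrite -gneg; apply: eq_bigr => z _; by rewrite -(satE true) integralN.
Qed.

End LatticePointCount.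

(** * Reciprocity for inscribed polytopes *)

Lemma dimension_gt0_nonempty (R : realType) (n : nat) (S : set 'rV[R]_n) :
  (0 < dimension S)%N -> S !=set0.
Proof.
move=> dS; apply: contrapT => S0; move: dS; rewrite lt0n => /negP; apply.
rewrite -leqn0; apply/bigmax_leqP => k /asboolP[x [V [Sx _ _]]].
by case: S0; exists x.
Qed.

Lemma ehr_quasi_eq (R : realType) (n : nat) (P Q : set 'rV[R]_n) (g : int -> R) :
  quasi_polynomial g -> eventually_equal g (fun t => (ehr_count P Q t)%:R) ->
  ehr_quasi P Q = g.
Proof.
move=> qg gE; rewrite /ehr_quasi.
case: xgetP => [f _ [qf [T fE]]|/(_ g)]; last by case.
have [T' gE'] := gE; apply: quasi_polynomial_unique => //.
exists (Num.max T T') => t; rewrite ge_max => /andP[Tt T't].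
by rewrite fE// gE'.
Qed.

Unset Implicit Arguments.

Theorem theorem7 (R : realType) (n d : nat) (P Q : set 'rV[R]_n)
    (ratP : rational_polytope P) (ratQ : rational_polytope Q)
    (dimP : dimension P = d) (dimQP : (dimension Q <= d)%N)
    (dimQ : (0 < dimension Q)%N) (QinP : inscribed Q P) :
  exists T : int, forall t : int, T <= t ->
    ehr P Q (- t) = (-1) ^+ d * (ehr_int P Q (t + 2))%:R /\
    (ehr_int P Q t)%:R = (-1) ^+ d * ehr P Q (- t + 2).
Proof.
have [x0 Qx0] := dimension_gt0_nonempty dimQ.
have Px0 : P x0 by case: QinP => QP _; apply: QP.
have [|k [D [r0 [L [q [FP [M PM]]]]]]] := rational_facet_presentation ratP.
  by exists x0.
have dE : d = \rank D by rewrite -dimP (fp_dimension FP) mxrank_map.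
have [g qg gE] := hom_region_reciprocity FP PM.
(* Reciprocity for the regions needs a positive height, and the height is [t - 1]. *)
have regions (t : int) : 2 <= t ->
    (ehr_count P Q t)%:R = g (t - 1) /\
    (ehr_int P Q t)%:R = (-1) ^+ d * g (1 - t).
  move=> t2; have [|gpos gneg] := gE (t - 1); first by lia.
  have t0 : 0 < t by lia.
  have tr a := translate_sub_dilate FP a t0 (ex_intro _ x0 Qx0) QinP.
  rewrite -[1 - t]opprB dE -gpos -gneg; split; congr (#|` fset_set _|%fset%:R).
    by apply/funext => a; apply/propext; have [h _] := tr a; apply: h.
  by apply/funext => a; apply/propext; have [_ h] := tr a; apply: h.
have quasiE : ehr_quasi P Q = fun t => g (t - 1).
  apply: ehr_quasi_eq; first exact: quasi_polynomial_shift.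
  by exists 2 => t /regions[-> _].
have sgn2 (x : R) : (-1) ^+ d * ((-1) ^+ d * x) = x.
  by rewrite mulrA -expr2 sqrr_sign mul1r.
(* For [t >= 2] neither [- t] nor [- t + 2] is positive, so [ehr] takes its quasi-polynomial branch
   at both, including the value 0. *)
exists 2 => t t2; rewrite /ehr !ifF; try by apply/negbTE; lia.
have [_ ->] : _ := regions (t + 2) ltac:(lia).
have [_ ->] := regions t t2.
rewrite quasiE sgn2; split; first by congr g; lia.
by congr (_ * g _); lia.
Qed.
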